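(* Consider the conservative finite difference scheme on a uniform cuboid grid $$\mathbf W_{i,j,k}^{n+1}=\mathbf W_{i,j,k}^n+\Delta t_n\mathbf L_{ijk}(\mathbf W^n),$$ $$\mathbf L_{ijk}(\mathbf W^n)=\mathbf S(\mathbf W_{i,j,k}^n)+\frac{\widehat{\mathbf H}^1_{i-\frac12,j,k}-\widehat{\mathbf H}^1_{i+\frac12,j,k}}{\Delta_1}+\frac{\widehat{\mathbf H}^2_{i,j-\frac12,k}-\widehat{\mathbf H}^2_{i,j+\frac12,k}}{\Delta_2}+\frac{\widehat{\mathbf H}^3_{i,j,k-\frac12}-\widehat{\mathbf H}^3_{i,j,k+\frac12}}{\Delta_3}.$$ Assume that the numerical fluxes are taken as the limited fluxes $\widehat{\mathbf H}^{1}_{i+\frac12,j,k}=\theta_{i+\frac12,j,k}\big(\widehat{\mathbf H}^{1,\mathtt{high}}_{i+\frac12,j,k}-\widehat{\mathbf H}^{1,\mathtt{LF}}_{i+\frac12,j,k}\big)+\widehat{\mathbf H}^{1,\mathtt{LF}}_{i+\frac12,j,k}$, and analogously $\widehat{\mathbf H}^{2}_{i,j+\frac12,k}$ with $\theta_{i,j+\frac12,k}$ and $\widehat{\mathbf H}^{3}_{i,j,k+\frac12}$ with $\theta_{i,j,k+\frac12}$, the parameters $\theta_{i+\frac12,j,k},\theta_{i,j+\frac12,k},\theta_{i,j,k+\frac12}$ being computed by the parametrized physical-constraint-preserving flux limiter described in the context. Then the resulting scheme is physical-constraint-preserving, i.e. $\mathbf W^0_{i,j,k}\in\mathcal G_*$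 for all $i,j,k$ implies $\mathbf W^n_{i,j,k}\in\mathcal G_*$ for all $i,j,k,n$, under the CFL-type condition (for all $n$ and all $i,j,k$) $$\Delta t_n\bigg(\sum_{\ell=1}^3\Delta_\ell^{-1}a_\star^{(\ell)}+\lambda_{\rm S}\bigg)<1,$$ where $\lambda_{\rm S}=0$ if $q(\mathbf S(\mathbf W_{i,j,k}^n))\ge0$, and otherwise $\lambda_{\rm S}>0$ solves $q\big(\mathbf W_{i,j,k}^n+\lambda_{\rm S}^{-1}\mathbf S(\mathbf W_{i,j,k}^n)\big)=0$.
   Context: Conventions: Greek tensor indices 0 to 3, Latin tensor indices 1 to 3, $x^0=t$, repeated tensor indices summed. The spacetime metric and its first derivatives are given: $g_{00}=-(\alpha^2-\beta_i\beta^i)$, $g_{0i}=\beta_i$, $g_{ij}=\gamma_{ij}$, with lapse $\alpha>0$, shift $\beta^i$, 3-metric $(\gamma_{ij})$ symmetric positive definite with inverse $\boldsymbol\Upsilon=(\gamma^{ij})$, $\gamma=\det(\gamma_{ij})$, $\sqrt{-g}=\alpha\sqrt\gamma$; $\Gamma^\lambda_{\mu\nu}$ are the Christoffel symbols. Spatial indices are raised/lowered with $\gamma^{ij},\gamma_{ij}$. Equation of state (EOS): $e(p,\rho)$ is $C^1$ on $(0,\infty)^2$, $h=1+e+p/\rho$, and for all $p,\rho>0$: $h\ge\sqrt{1+p^2/\rho^2}+p/\rho$; $h(\frac1\rho-\partial_ph)<\partial_\rho h<0$; $\lim_{p\to0^+}e=0$, $\lim_{p\to+\infty}e=+\infty$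 for fixed $\rho$. Ideal EOS: $h=1+\frac{\Gamma p}{(\Gamma-1)\rho}$, $\Gamma\in(1,2]$. Sound speed: $c_s^2=h^{-1}\partial_\rho h/(\frac1\rho-\partial_ph)\in(0,1)$. Physical state: $\rho>0$, $p>0$, $e>0$, $\mathbf v=(v_1,v_2,v_3)$ with $v=\sqrt{v_jv^j}<1$, $w=(1-v^2)^{-1/2}$; $\mathbf U=(D,\mathbf m,E)^\top$, $D=\rho w$, $\mathbf m=\rho hw^2\mathbf v$, $E=\rho hw^2-p$. The set of such $\mathbf U$ is $\mathcal G_\gamma=\{D>0,\ E>\sqrt{D^2+\mathbf m\boldsymbol\Upsilon\mathbf m^\top}\}$, and $\rho,p,\mathbf v$ are functions of $\mathbf U\in\mathcal G_\gamma$. Flux $\mathbf F^i=(D\tilde v^i,\tilde v^i\mathbf m+p\mathbf e_i,E\tilde v^i+pv^i)^\top$, $\tilde v^i=v^i-\beta^i/\alpha$, $\mathbf e_i$ the $i$-th row of the $3\times3$ identity. Source $\mathbf Q=\big(0,\ T^{\mu\nu}(\partial_\mu g_{\nu j}-\Gamma^\delta_{\nu\mu}g_{\delta j})_{j=1,2,3},\ \alpha(T^{\mu0}\partial_\mu\ln\alpha-T^{\mu\nu}\Gamma^0_{\nu\mu})\big)^\top$, $T^{\mu\nu}=\rho hu^\mu u^\nu+pg^{\mu\nu}$, $u^0=w/\alpha$, $u^i=w\tilde v^i$. W-form of the general relativistic hydrodynamic equations: $\partial_t\mathbf W+\partial_{x^j}\mathbf H^j(\mathbf W)=\mathbf S(\mathbf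 W)$, where $\mathbf W=\sqrt\gamma\,\boldsymbol\Sigma\mathbf U$, $\boldsymbol\Sigma=\mathrm{diag}\{1,R,1\}$ with $R^\top R=\boldsymbol\Upsilon$ (e.g. $R$ the upper triangular Cholesky factor, or $R=\boldsymbol\Upsilon^{1/2}$), $\mathbf H^j=\sqrt{-g}\,\boldsymbol\Sigma\mathbf F^j$, $\mathbf S=\sqrt\gamma\,\frac{\partial\boldsymbol\Sigma}{\partial t}\mathbf U+\sqrt{-g}\big(\mathbf Q+\frac{\partial\boldsymbol\Sigma}{\partial x^j}\mathbf F^j\big)$. $\mathcal G_*=\{\mathbf W=(W_0,\dots,W_4)^\top: W_0>0,\ q(\mathbf W)>0\}$, $q(\mathbf W)=W_4-(\sum_{i=0}^3W_i^2)^{1/2}$; $\mathbf U\in\mathcal G_\gamma\iff\mathbf W\in\mathcal G_*$. Speed bound: for $\boldsymbol\xi\ne\mathbf0$, $\mathbf W\in\mathcal G_*$: $\eta_\xi(\mathbf W)=\alpha\varrho_\xi$ with $\varrho_\xi=\sqrt{\xi_j\xi^j}+|\xi_j\beta^j|/\alpha$ for a general EOS; for the ideal EOS one may also take $\varrho_\xi=\frac{1}{1-v^2c_s^2}\{|\xi_jv^j|(1-c_s^2)+c_sw^{-1}\sqrt{(1-v^2c_s^2)\xi_j\xi^j-(1-c_s^2)(\xi_jv^j)^2}\}+|\xi_j\beta^j|/\alpha$. Grid: uniform cuboid mesh with grid points $(\mathtt x_i,\mathtt y_j,\mathtt z_k)$ and constant step sizes $\Delta_1,\Delta_2,\Delta_3$;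 time levels $t_0=0$, $t_{n+1}=t_n+\Delta t_n$; $\mathbf W^n_{i,j,k}$ approximates $\mathbf W$ at $(t_n,\mathtt x_i,\mathtt y_j,\mathtt z_k)$, and the metric entering $\mathbf H^\ell(\mathbf W^n_{i,j,k})$, $\mathbf S(\mathbf W^n_{i,j,k})$, $\eta_\xi(\mathbf W^n_{i,j,k})$ is that at this point. The fluxes $\widehat{\mathbf H}^{\ell,\mathtt{high}}$ are given high-order numerical fluxes (constructed by any appropriate technique, e.g. WENO). The Lax-Friedrichs fluxes are $\widehat{\mathbf H}^{1,\mathtt{LF}}_{i+\frac12,j,k}=\widehat{\mathbf H}^1(\mathbf W^n_{i,j,k},\mathbf W^n_{i+1,j,k})$ and analogously $\widehat{\mathbf H}^{2,\mathtt{LF}}_{i,j+\frac12,k}$, $\widehat{\mathbf H}^{3,\mathtt{LF}}_{i,j,k+\frac12}$, with $\widehat{\mathbf H}^\ell(\mathbf W^-,\mathbf W^+)=\frac12(\mathbf H^\ell(\mathbf W^-)+\mathbf H^\ell(\mathbf W^+)-a_\star^{(\ell)}(\mathbf W^+-\mathbf W^-))$, $a_\star^{(\ell)}\ge\max_{i,j,k}\eta_{\xi_\ell}(\mathbf W^n_{i,j,k})$, $\boldsymbol\xi_\ell$ the $\ell$-th row of the $3\times3$ identity. Flux limiter (at each time step). For $\boldsymbol\theta=(\theta^{(1)},\dots,\theta^{(6)})\in[0,1]^6$ let $\mathbf W_{i,j,k}(\boldsymbol\theta)=\mathbf W_{i,j,k}(\mathbf 0)+\sum_{\ell=1}^6\theta^{(\ell)}\mathbf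 C_\ell$ be the result of one step of the scheme at $(i,j,k)$ when the limiting parameters at the interfaces $(i-\frac12,j,k),(i+\frac12,j,k),(i,j-\frac12,k),(i,j+\frac12,k),(i,j,k-\frac12),(i,j,k+\frac12)$ are $\theta^{(1)},\dots,\theta^{(6)}$. Thus $\mathbf W_{i,j,k}(\mathbf0)$ is the step with all fluxes replaced by Lax-Friedrichs fluxes, and $\mathbf C_{1,2}=\pm\frac{\Delta t_n}{\Delta_1}(\widehat{\mathbf H}^{1,\mathtt{high}}_{i\mp\frac12,j,k}-\widehat{\mathbf H}^{1,\mathtt{LF}}_{i\mp\frac12,j,k})$, $\mathbf C_{3,4}=\pm\frac{\Delta t_n}{\Delta_2}(\widehat{\mathbf H}^{2,\mathtt{high}}_{i,j\mp\frac12,k}-\widehat{\mathbf H}^{2,\mathtt{LF}}_{i,j\mp\frac12,k})$, $\mathbf C_{5,6}=\pm\frac{\Delta t_n}{\Delta_3}(\widehat{\mathbf H}^{3,\mathtt{high}}_{i,j,k\mp\frac12}-\widehat{\mathbf H}^{3,\mathtt{LF}}_{i,j,k\mp\frac12})$. Let $W_{0,i,j,k}(\boldsymbol\theta)$ and $C_{0,\ell}$ be the first components of $\mathbf W_{i,j,k}(\boldsymbol\theta)$ and $\mathbf C_\ell$. Let $\epsilon=\min\{10^{-12},\min_{i,j,k}W_{0,i,j,k}(\mathbf0),\min_{i,j,k}q(\mathbf W_{i,j,k}(\mathbf0))\}$, let $\varepsilon_0>0$ be a small parameter to avoid division by zero (it may be taken as $10^{-12}$), and $\Theta=\{\boldsymbol\theta\in[0,1]^6: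 W_{0,i,j,k}(\boldsymbol\theta)\ge\epsilon,\ q(\mathbf W_{i,j,k}(\boldsymbol\theta))\ge\epsilon\}$. For each $(i,j,k)$: (a) with $\mathcal N_c=\{\mu\in\{1,\dots,6\}: C_{0,\mu}<0\}$, set $\Lambda_0^{(\ell)}=\min\big\{1,\frac{W_{0,i,j,k}(\mathbf0)-\epsilon}{\varepsilon_0+\sum_{\mu\in\mathcal N_c}|C_{0,\mu}|}\big\}$ if $C_{0,\ell}<0$, and $\Lambda_0^{(\ell)}=1$ otherwise; (b) for each $\boldsymbol\ell=(\ell_1,\dots,\ell_6)\in\{0,1\}^6$ let $\boldsymbol{\mathcal V}_{\boldsymbol\ell}=(\ell_1\Lambda_0^{(1)},\dots,\ell_6\Lambda_0^{(6)})$; if $\boldsymbol{\mathcal V}_{\boldsymbol\ell}\in\Theta$ set $\hat{\boldsymbol{\mathcal V}}_{\boldsymbol\ell}=\boldsymbol{\mathcal V}_{\boldsymbol\ell}$; otherwise compute the unique solution $\lambda\in[0,1)$ of $q(\mathbf W_{i,j,k}(\lambda\boldsymbol{\mathcal V}_{\boldsymbol\ell}))=\epsilon$ (the uniqueness being ensured by the concavity of $q$) and set $\hat{\boldsymbol{\mathcal V}}_{\boldsymbol\ell}=\lambda\boldsymbol{\mathcal V}_{\boldsymbol\ell}$; then $\Lambda^{(\mu)}_{i,j,k}=\min\{\hat{\mathcal V}^{(\mu)}_{\boldsymbol\ell}:\boldsymbol\ell\in\{0,1\}^6,\ \ell_\mu=1\}$, $\mu=1,\dots,6$. Finally $\theta_{i+\frac12,j,k}=\min\{\Lambda^{(2)}_{i,j,k},\Lambda^{(1)}_{i+1,j,k}\}$,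 $\theta_{i,j+\frac12,k}=\min\{\Lambda^{(4)}_{i,j,k},\Lambda^{(3)}_{i,j+1,k}\}$, $\theta_{i,j,k+\frac12}=\min\{\Lambda^{(6)}_{i,j,k},\Lambda^{(5)}_{i,j,k+1}\}$. *)

(* Defs.v *)
From mathcomp Require Export all_boot all_order all_algebra.
From mathcomp Require Export all_classical all_reals all_analysis.

Set Implicit Arguments.
Unset Strict Implicit.
Unset Printing Implicit Defensive.

Export Order.TTheory GRing.Theory Num.Theory numFieldNormedType.Exports.
Local Open Scope classical_set_scope.
Local Open Scope ring_scope.

Section EquationOfState.
Context {R : realType}.
Implicit Types (f e : R -> R -> R) (p rho : R).

Definition d_p f p rho : R := derive1 (f^~ rho) p.
Definition d_rho f p rho : R := derive1 (f p) rho.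

Definition C1_quadrant f : Prop := forall p rho, 0 < p -> 0 < rho ->
  [/\ derivable (f^~ rho) p 1,
      derivable (f p) rho 1,
      {for (p, rho), continuous (fun z : R * R => d_p f z.1 z.2)} &
      {for (p, rho), continuous (fun z : R * R => d_rho f z.1 z.2)}].

(* [e p rho] is the specific internal energy *)
Definition enthalpy e p rho : R := 1 + e p rho + p / rho.

Record eos_admissible e : Prop := EosAdmissible {
  eos_C1 : C1_quadrant e;
  eos_enthalpy_ge : forall p rho, 0 < p -> 0 < rho ->
    Num.sqrt (1 + p ^+ 2 / rho ^+ 2) + p / rho <= enthalpy e p rho;
  eos_d_enthalpy : forall p rho, 0 < p -> 0 < rho ->
    enthalpy e p rho * (rho^-1 - d_p (enthalpy e) p rho)
      < d_rho (enthalpy e) p rho < 0;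
  eos_lim0 : forall rho, 0 < rho -> e p rho @[p --> 0^'+] --> 0;
  eos_limy : forall rho, 0 < rho -> e p rho @[p --> +oo] --> +oo }.

Definition ideal_eos e : Prop := exists2 Gam : R, 1 < Gam <= 2 &
  forall p rho, 0 < p -> 0 < rho ->
    enthalpy e p rho = 1 + Gam * p / ((Gam - 1) * rho).

Definition sound_speed2 e p rho : R :=
  (enthalpy e p rho)^-1 * d_rho (enthalpy e) p rho
    / (rho^-1 - d_p (enthalpy e) p rho).

Definition sound_speed e p rho : R := Num.sqrt (sound_speed2 e p rho).

End EquationOfState.

(* coordinates (x^0, x^1, x^2, x^3) with x^0 = t *)
Definition event (R : realType) := 'rV[R]_4.

(* [shift] has the contravariant components beta^i.  [frame] is the matrix
   field, called R in Sigma = diag(1, R, 1), with R^T R = gamma^-1. *)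
Record spacetime (R : realType) := Spacetime {
  lapse : event R -> R;
  shift : event R -> 'cV[R]_3;
  metric3 : event R -> 'M[R]_3;
  frame : event R -> 'M[R]_3 }.

Section Geometry.
Context {R : realType} (M : spacetime R).
Implicit Types (x : event R) (mu nu lam i j : 'I_4).

Record spacetime_at x : Prop := SpacetimeAt {
  lapse_gt0 : 0 < lapse M x;
  metric3_sym : (metric3 M x)^T = metric3 M x;
  metric3_pos : forall u : 'cV[R]_3, u != 0 ->
    0 < (u^T *m metric3 M x *m u) 0 0;
  frameE : (frame M x)^T *m frame M x = invmx (metric3 M x);
  lapse_diff : differentiable (lapse M) x;
  shift_diff : forall k, differentiable (fun y => shift M y k 0) x;
  metric3_diff : forall k l, differentiable (fun y => metric3 M y k l) x;
  frame_diff : forall k l, differentiable (fun y => frame M y k l) x }.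

Definition Upsilon x : 'M[R]_3 := invmx (metric3 M x).

Definition sqrt_gamma x : R := Num.sqrt (\det (metric3 M x)).

(* sqrt(- det g), by the identity det g = - alpha^2 det gamma *)
Definition sqrt_g x : R := lapse M x * sqrt_gamma x.

Definition shift_low x : 'cV[R]_3 := metric3 M x *m shift M x.

(* g_{mu nu}; the index 0 is the time index, [lift ord0 k] the spatial index
   of the k-th spatial direction. *)
Definition metric4 x : 'M[R]_4 :=
  block_mx ((- (lapse M x ^+ 2 - ((shift_low x)^T *m shift M x) 0 0))%:M
              : 'M[R]_1)
           (shift_low x)^T
           (shift_low x) (metric3 M x).

Definition metric4_inv x : 'M[R]_4 := invmx (metric4 x).

Definition partial mu (f : event R -> R) x : R := 'D_(delta_mx 0 mu) f x.

(* Gamma^lam_{mu nu}: the contravariant index comes first. *)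
Definition christoffel x lam mu nu : R :=
  2^-1 * \sum_(s < 4) metric4_inv x lam s *
    (partial mu (fun y => metric4 y s nu) x
     + partial nu (fun y => metric4 y s mu) x
     - partial s (fun y => metric4 y mu nu) x).

Definition Sigma x : 'M[R]_5 :=
  block_mx (1%:M : 'M[R]_1) (0 : 'M[R]_(1, 4)) 0
    (block_mx (frame M x) 0 0 (1%:M : 'M[R]_1) : 'M[R]_4).

Definition partial_Sigma mu x : 'M[R]_5 :=
  \matrix_(k, l) partial mu (fun y => Sigma y k l) x.

(* u_j u^j, for covariant components u_j *)
Definition covec_sqr x (u : 'cV[R]_3) : R := (u^T *m Upsilon x *m u) 0 0.

End Geometry.

Section Hydrodynamics.
Context {R : realType} (e : R -> R -> R) (M : spacetime R).
Implicit Types (x : event R) (i j k : 'I_3).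

(* primitive variables (rho, (v_1, v_2, v_3), p), covariant velocity *)
Definition prim := (R * 'cV[R]_3 * R)%type.
Implicit Types (z : prim) (U W : 'cV[R]_5) (xi : 'cV[R]_3).

Definition density z : R := z.1.1.
Definition velocity z : 'cV[R]_3 := z.1.2.
Definition pressure z : R := z.2.
Definition energy z : R := e (pressure z) (density z).
Definition enth z : R := enthalpy e (pressure z) (density z).
Definition speed2 x z : R := covec_sqr M x (velocity z).
Definition lorentz x z : R := (Num.sqrt (1 - speed2 x z))^-1.

Definition physical x z : Prop :=
  [/\ 0 < density z, 0 < pressure z, 0 < energy z &
      Num.sqrt (speed2 x z) < 1].

Definition state5 (d : R) (m : 'cV[R]_3) (E : R) : 'cV[R]_5 :=
  col_mx (d%:M : 'cV[R]_1) (col_mx m (E%:M : 'cV[R]_1) : 'cV[R]_4).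

Definition rhohw2 x z : R := density z * enth z * lorentz x z ^+ 2.
Definition consD x z : R := density z * lorentz x z.
Definition consm x z : 'cV[R]_3 := rhohw2 x z *: velocity z.
Definition consE x z : R := rhohw2 x z - pressure z.
Definition cons_of_prim x z : 'cV[R]_5 :=
  state5 (consD x z) (consm x z) (consE x z).

(* The inverse of U |-> sqrt(gamma) Sigma U. *)
Definition U_of_W x W : 'cV[R]_5 :=
  (sqrt_gamma M x)^-1 *: (invmx (Sigma M x) *m W).
(* On the states U of a physical z, this z is unique; [get] selects it. *)
Definition prim_of_cons x U : prim :=
  [get z | physical x z /\ cons_of_prim x z = U].
Definition prim_of_W x W : prim := prim_of_cons x (U_of_W x W).

Definition vel_up x z : 'cV[R]_3 := Upsilon M x *m velocity z.
Definition vel_tilde x z : 'cV[R]_3 :=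
  vel_up x z - (lapse M x)^-1 *: shift M x.

Definition flux i x z : 'cV[R]_5 :=
  state5 (consD x z * vel_tilde x z i 0)
         (vel_tilde x z i 0 *: consm x z + pressure z *: delta_mx i 0)
         (consE x z * vel_tilde x z i 0 + pressure z * vel_up x z i 0).

Definition four_vel x z : 'cV[R]_4 :=
  col_mx ((lorentz x z / lapse M x)%:M : 'cV[R]_1)
         (lorentz x z *: vel_tilde x z).

Definition stress x z : 'M[R]_4 :=
  (density z * enth z) *: (four_vel x z *m (four_vel x z)^T)
  + pressure z *: metric4_inv M x.

Definition source_m x z : 'cV[R]_3 := \col_j
  \sum_(mu < 4) \sum_(nu < 4) stress x z mu nu *
    (partial mu (fun y => metric4 M y nu (lift ord0 j)) x
     - \sum_(d < 4) christoffel M x d nu mu * metric4 M x d (lift ord0 j)).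

Definition source_E x z : R :=
  lapse M x *
  (\sum_(mu < 4) stress x z mu 0 * partial mu (fun y => ln (lapse M y)) x
   - \sum_(mu < 4) \sum_(nu < 4) stress x z mu nu * christoffel M x 0 nu mu).

Definition source_Q x z : 'cV[R]_5 := state5 0 (source_m x z) (source_E x z).

(* H^l(W) and S(W), with the metric taken at x *)
Definition H_flux i x W : 'cV[R]_5 :=
  sqrt_g M x *: (Sigma M x *m flux i x (prim_of_W x W)).

Definition S_source x W : 'cV[R]_5 :=
  sqrt_gamma M x *: (partial_Sigma M 0 x *m U_of_W x W)
  + sqrt_g M x *:
    (source_Q x (prim_of_W x W)
     + \sum_(j < 3)
         partial_Sigma M (lift ord0 j) x *m flux j x (prim_of_W x W)).

Definition shift_speed xi x : R := `|(xi^T *m shift M x) 0 0| / lapse M x.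

Definition eta_general xi x W : R :=
  lapse M x * (Num.sqrt (covec_sqr M x xi) + shift_speed xi x).

Definition eta_ideal xi x W : R :=
  let z := prim_of_W x W in
  let cs := sound_speed e (pressure z) (density z) in
  let v2 := speed2 x z in
  let xiv := (xi^T *m vel_up x z) 0 0 in
  lapse M x *
  ((1 - v2 * cs ^+ 2)^-1 *
     (`|xiv| * (1 - cs ^+ 2) +
      cs * (lorentz x z)^-1 *
        Num.sqrt ((1 - v2 * cs ^+ 2) * covec_sqr M x xi
                  - (1 - cs ^+ 2) * xiv ^+ 2))
   + shift_speed xi x).

End Hydrodynamics.

Section AdmissibleSet.
Context {R : realType}.
Implicit Type W : 'cV[R]_5.

Definition q W : R :=
  W ord_max 0 - Num.sqrt (\sum_(i < 5 | i != ord_max) W i 0 ^+ 2).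

Definition Gstar W : Prop := 0 < W 0 0 /\ 0 < q W.

End AdmissibleSet.

Definition speed_bound (R : realType) (e : R -> R -> R) (M : spacetime R)
    (eta : 'cV[R]_3 -> event R -> 'cV[R]_5 -> R) : Prop :=
  (forall xi x W, xi != 0 -> Gstar W -> eta xi x W = eta_general M xi x W) \/
  (ideal_eos e /\
   forall xi x W, xi != 0 -> Gstar W -> eta xi x W = eta_ideal e M xi x W).

(* The grid index (i, j, k); [c + unit_ix l] is the next grid point in
   direction l, and a quantity attached to the interface c + (1/2) unit_ix l
   is indexed by (l, c). *)
Definition grid_ix := 'rV[int]_3.
Definition unit_ix (l : 'I_3) : grid_ix := delta_mx 0 l.

Definition grid_event (R : realType) (t : R) (xo dx : 'I_3 -> R)
    (c : grid_ix) : event R :=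
  row_mx (t%:M : 'rV[R]_1) (\row_(l < 3) (xo l + (c 0 l)%:~R * dx l)).

(* (l, false) and (l, true) are the interfaces of a grid point c at
   c - (1/2) unit_ix l and at c + (1/2) unit_ix l: in the order
   (0, false), (0, true), (1, false), ... they carry the limiting parameters
   theta^(1), theta^(2), theta^(3), ... *)
Definition face := ('I_3 * bool)%type.

Section Scheme.
Context {R : realType}.
Notation state := 'cV[R]_5.
Notation face_flux := ('I_3 -> grid_ix -> 'cV[R]_5).
Implicit Types (c : grid_ix) (l : 'I_3).

Definition LF_flux (e : R -> R -> R) (M : spacetime R) (a : 'I_3 -> R)
    (X : grid_ix -> event R) (w : grid_ix -> state) : face_flux :=
  fun l c => 2^-1 *:
    (H_flux e M l (X c) (w c)
     + H_flux e M l (X (c + unit_ix l)) (w (c + unit_ix l))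
     - a l *: (w (c + unit_ix l) - w c)).

Definition limited_flux (theta : 'I_3 -> grid_ix -> R) (high LF : face_flux)
    : face_flux :=
  fun l c => theta l c *: (high l c - LF l c) + LF l c.

Definition L_op (dx : 'I_3 -> R) (src : grid_ix -> state) (F : face_flux)
    c : state :=
  src c + \sum_(l < 3) (dx l)^-1 *: (F l (c - unit_ix l) - F l c).

Section Limiter.
(* w = W^n, src = S(W^n) *)
Variables (dt : R) (dx : 'I_3 -> R) (w src : grid_ix -> state).
Variables (high LF : face_flux).
Implicit Types (f mu : face) (th : {ffun face -> R}) (v : {ffun face -> bool}).

Definition LF_step c : state := w c + dt *: L_op dx src LF c.

Definition C_corr c f : state :=
  let: (l, side) := f in
  if side then - (dt / dx l) *: (high l c - LF l c)
  else (dt / dx l) *: (high l (c - unit_ix l) - LF l (c - unit_ix l)).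

Definition W_theta c th : state := LF_step c + \sum_f th f *: C_corr c f.

Definition is_min (A : set R) (m : R) : Prop := A m /\ lbound A m.

Definition is_limiter_eps (eps : R) : Prop :=
  is_min [set y | y = 10 ^- 12 \/
                  (exists c, y = LF_step c 0 0) \/
                  (exists c, y = q (LF_step c))] eps.

Variables (eps eps0 : R).

Definition in_Theta c th : bool :=
  [&& [forall f, 0 <= th f <= 1],
      eps <= W_theta c th 0 0 & eps <= q (W_theta c th)].

Definition Lambda0 c f : R :=
  if C_corr c f 0 0 < 0 then
    Num.min 1 ((LF_step c 0 0 - eps) /
               (eps0 + \sum_(mu | C_corr c mu 0 0 < 0) `|C_corr c mu 0 0|))
  else 1.

Definition vertex c v : {ffun face -> R} :=
  [ffun f => (v f)%:R * Lambda0 c f].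

Definition scale_theta (s : R) th : {ffun face -> R} := [ffun f => s * th f].

(* A choice [lam] of the solutions lambda of q(W(lambda V)) = eps. *)
Variable (lam : grid_ix -> {ffun face -> bool} -> R).

Definition is_vertex_scaling : Prop := forall c v,
  ~~ in_Theta c (vertex c v) ->
  0 <= lam c v < 1 /\ q (W_theta c (scale_theta (lam c v) (vertex c v))) = eps.

Definition vertex_hat c v : {ffun face -> R} :=
  if in_Theta c (vertex c v) then vertex c v
  else scale_theta (lam c v) (vertex c v).

(* All the values minimized are at most 1, so the default 1 is harmless. *)
Definition Lambda c mu : R :=
  \big[Num.min/1]_(v : {ffun face -> bool} | v mu) vertex_hat c v mu.

Definition limiter_theta l c : R :=
  Num.min (Lambda c (l, true)) (Lambda (c + unit_ix l) (l, false)).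

End Limiter.
End Scheme.

(* The restriction lambda_S at a grid point, for W = w and S(W) = s. *)
Definition is_lambda_S (R : realType) (w s : 'cV[R]_5) (lamS : R) : Prop :=
  if 0 <= q s then lamS = 0 else 0 < lamS /\ q (w + lamS^-1 *: s) = 0.

(* Main.v *)
(* The set Gstar is the interior of a closed convex cone on which q is concave
   and positively homogeneous.

   The Lax-Friedrichs step is a positive combination of W, of W + S / lambda_S
   and of the states a W +- H(W) at the neighbouring points, each taken with the
   metric of its own point; the terms H(W) at the central point cancel.  The
   last states lie in the closed cone: multiplying by the frame reduces the claim
   to special relativity, where for a normal n of squared length N and a speed s,
   with k = n . v, membership amounts to
     (s + k)^2 (E^2 - D^2 - m^2 - p^2) + p^2 (s^2 - N) >= 0.
   The primitive variables are recovered from W by solving a scalar equation for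
   the pressure with the intermediate value theorem.

   For the limiter, the box [0, Lambda] is contained in Theta: Theta is convex
   and contains 0, and a point theta = (y_f Lambda0_f)_f of the box, with s the
   maximum of y, attained at f0, is a convex combination of the points
   s V_v with v f0 = 1, all of which lie in Theta. *)
Require Import Defs.
From mathcomp Require Import ring lra.
Set Implicit Arguments.
Unset Strict Implicit.
Unset Printing Implicit Defensive.
Local Open Scope classical_set_scope.
Local Open Scope ring_scope.

(** * The admissible cone *)

Section Euclid.
Context {R : rcfType} {I : finType}.
Implicit Types (P : pred I) (u v : I -> R).

(* Lagrange's identity. *)
Lemma sum_cauchy_schwarz P u v :
  (\sum_(i | P i) u i * v i) ^+ 2
    <= (\sum_(i | P i) u i ^+ 2) * (\sum_(i | P i) v i ^+ 2).
Proof.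
have H : 0 <= \sum_(i | P i) \sum_(j | P j) (u i * v j - u j * v i) ^+ 2.
  by apply: sumr_ge0 => i _; apply: sumr_ge0 => j _; exact: sqr_ge0.
have E : \sum_(i | P i) \sum_(j | P j) (u i * v j - u j * v i) ^+ 2 =
   (\sum_(i | P i) u i ^+ 2) * (\sum_(i | P i) v i ^+ 2)
   + (\sum_(i | P i) v i ^+ 2) * (\sum_(i | P i) u i ^+ 2)
   - 2 * ((\sum_(i | P i) u i * v i) * (\sum_(i | P i) u i * v i)).
  rewrite !big_distrlr /= mulr_sumr -sumrN -!big_split /=.
  apply: eq_bigr => i _; rewrite mulr_sumr -sumrN -!big_split /=.
  by apply: eq_bigr => j _; ring.
rewrite E in H; rewrite expr2; lra.
Qed.

Lemma sqrt_sum_sqrD P u v :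
  Num.sqrt (\sum_(i | P i) (u i + v i) ^+ 2)
  <= Num.sqrt (\sum_(i | P i) u i ^+ 2) + Num.sqrt (\sum_(i | P i) v i ^+ 2).
Proof.
have pos w : 0 <= \sum_(i | P i) w i ^+ 2 :> R.
  by apply: sumr_ge0 => i _; exact: sqr_ge0.
rewrite -[leRHS]ger0_norm ?addr_ge0 ?sqrtr_ge0// -sqrtr_sqr ler_wsqrtr//.
rewrite sqrrD !sqr_sqrtr//.
have -> : \sum_(i | P i) (u i + v i) ^+ 2 = \sum_(i | P i) u i ^+ 2
   + (\sum_(i | P i) u i * v i) *+ 2 + \sum_(i | P i) v i ^+ 2.
  by rewrite -sumrMnl -!big_split /=; apply: eq_bigr => i _; rewrite sqrrD.
rewrite lerD2r lerD2l ler_pMn2r// -sqrtrM//.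
apply: le_trans (ler_norm _) _.
by rewrite -sqrtr_sqr ler_wsqrtr// sum_cauchy_schwarz.
Qed.
End Euclid.

Section Cone.
Context {R : realType}.
Implicit Types (U V W : 'cV[R]_5).

(** [q] is a linear form minus a Euclidean norm, so this is the triangle inequality; with [qZ] it
    yields concavity. *)
Lemma q_superadditive U V : q U + q V <= q (U + V).
Proof.
rewrite /q mxE; set a := Num.sqrt _; set b := Num.sqrt _; set c := Num.sqrt _.
suff : c <= a + b by lra.
have -> : c = Num.sqrt (\sum_(i < 5 | i != ord_max) (U i 0 + V i 0) ^+ 2).
  by congr Num.sqrt; apply: eq_bigr => i _; rewrite mxE.
exact: sqrt_sum_sqrD.
Qed.

Lemma qZ (k : R) U : 0 <= k -> q (k *: U) = k * q U.
Proof.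
move=> k0; rewrite /q mxE mulrBr; congr (_ - _).
rewrite -[in RHS](ger0_norm k0) -sqrtr_sqr -sqrtrM ?sqr_ge0//.
by rewrite mulr_sumr; congr Num.sqrt; apply: eq_bigr => i _; rewrite mxE exprMn.
Qed.

(* The closure of [Gstar]. *)
Definition Gbar W : Prop := 0 <= W 0 0 /\ 0 <= q W.

Lemma GbarD U V : Gbar U -> Gbar V -> Gbar (U + V).
Proof.
move=> [u0 uq] [v0 vq]; split; first by rewrite mxE addr_ge0.
by apply: le_trans (q_superadditive _ _); rewrite addr_ge0.
Qed.

Lemma GbarZ (k : R) U : 0 <= k -> Gbar U -> Gbar (k *: U).
Proof. by move=> k0 [u0 uq]; split; rewrite ?mxE ?qZ ?mulr_ge0. Qed.

Lemma Gbar0 : Gbar 0.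
Proof.
split; first by rewrite mxE.
by rewrite -(scale0r (0 : 'cV[R]_5)) qZ ?mul0r.
Qed.

Lemma Gbar_sum (I : finType) (F : I -> 'cV[R]_5) :
  (forall i, Gbar (F i)) -> Gbar (\sum_i F i).
Proof. by move=> HF; apply: (big_ind Gbar Gbar0 GbarD). Qed.

(** Thanks to this, a sum of cone elements needs only one strictly admissible term. *)
Lemma GstarD U V : Gstar U -> Gbar V -> Gstar (U + V).
Proof.
move=> [u0 uq] [v0 vq]; split; first by rewrite mxE ltr_wpDr.
by apply: lt_le_trans (q_superadditive _ _); rewrite ltr_wpDr.
Qed.

Lemma GstarZ (k : R) U : 0 < k -> Gstar U -> Gstar (k *: U).
Proof.
by move=> k0 [u0 uq]; split; rewrite ?mxE ?(qZ _ (ltW k0)) ?mulr_gt0.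
Qed.

End Cone.

(** * The flux limiter *)

Section Cube.
Context {R : realFieldType} {T : finType}.
Implicit Types (y z : {ffun T -> R}).

Definition mix (s : R) y z : {ffun T -> R} :=
  [ffun f => (1 - s) * y f + s * z f].

(** Induction on the number of coordinates other than 0 and 1: a point with such a coordinate [f] is
    a mixture of the two points where that coordinate is reset to 0 and to 1. Since [y f0 = 1], [f0]
    is never reset, so only vertices of the face [y f0 = 1] occur. *)
Lemma cube_convex (P : {ffun T -> R} -> Prop) (f0 : T) :
  (forall s y z, 0 <= s <= 1 -> P y -> P z -> P (mix s y z)) ->
  (forall v : {ffun T -> bool}, v f0 -> P [ffun f => (v f)%:R]) ->
  forall y, y f0 = 1 -> (forall f, 0 <= y f <= 1) -> P y.
Proof.
move=> Pmix Pv y.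
pose B y f := (y f != 0) && (y f != 1).
have [n] := ubnP #|[pred f | B y f]|.
elim: n y => // n IH y; rewrite ltnS => card_y y1 y01.
have [[f Bf]|noB] := pselect (exists f, B y f); last first.
  pose v : {ffun T -> bool} := [ffun f => y f == 1].
  have -> : y = [ffun f => (v f)%:R].
    apply/ffunP => f; rewrite !ffunE; case: eqVneq => // ny1.
    by have [//|ny0] := eqVneq (y f) 0; case: noB; exists f; rewrite /B ny0.
  by apply: Pv; rewrite ffunE y1 eqxx.
have ff0 : f0 != f by apply: contraTneq Bf => <-; rewrite /B y1 eqxx andbF.
pose set_y (b : R) : {ffun T -> R} := [ffun g => if g == f then b else y g].
have set_yE b g : set_y b g = if g == f then b else y g by rewrite ffunE.
have IHb b : b = 0 \/ b = 1 -> P (set_y b).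
  move=> b01; apply: IH => [||g].
  - apply: leq_trans card_y; apply: proper_card; apply/properP; split.
      apply/fintype.subsetP => g; rewrite !inE /B !set_yE.
      by case: (eqVneq g f) => [->|//]; case: b01 => ->; rewrite eqxx ?andbF.
    exists f; rewrite inE// /B !set_yE eqxx.
    by case: b01 => ->; rewrite eqxx ?andbF.
  - by rewrite set_yE (negbTE ff0).
  - by rewrite set_yE; case: eqP => // _; case: b01 => ->; rewrite ?lexx ?ler01.
have -> : y = mix (y f) (set_y 0) (set_y 1).
  by apply/ffunP => g; rewrite ffunE !set_yE; case: eqP => [->|_]; ring.
by apply: Pmix => //; apply: IHb; [left|right].
Qed.
End Cube.

Section Limiter.
Context {R : realType}.
Notation state := 'cV[R]_5.
Variables (dt : R) (dx : 'I_3 -> R) (w src : grid_ix -> state).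
Variables (high LF : 'I_3 -> grid_ix -> state).
Variables (eps eps0 : R) (lam : grid_ix -> {ffun face -> bool} -> R).
Hypothesis eps0_gt0 : 0 < eps0.
Hypothesis eps_le : forall c,
  eps <= LF_step dt dx w src LF c 0 0 /\ eps <= q (LF_step dt dx w src LF c).
Hypothesis lamP : is_vertex_scaling dt dx w src high LF eps eps0 lam.
Implicit Types (c : grid_ix) (th : {ffun face -> R}) (v : {ffun face -> bool}).

Local Notation step := (LF_step dt dx w src LF).
Local Notation corr := (C_corr dt dx high LF).
Local Notation Wth := (W_theta dt dx w src high LF).
Local Notation inTh := (in_Theta dt dx w src high LF eps).
Local Notation La0 := (Lambda0 dt dx w src high LF eps eps0).
Local Notation vert := (vertex dt dx w src high LF eps eps0).
Local Notation hat := (vertex_hat dt dx w src high LF eps eps0 lam).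
Local Notation La := (Lambda dt dx w src high LF eps eps0 lam).

Lemma W_theta_mix c s th th' :
  Wth c (mix s th th') = (1 - s) *: Wth c th + s *: Wth c th'.
Proof.
rewrite /W_theta; move: (step c) => W0.
rewrite !scalerDr !scaler_sumr addrACA -scalerDl subrK scale1r.
rewrite -big_split /=; congr (_ + _); apply: eq_bigr => f _.
by rewrite ffunE !scalerA -scalerDl.
Qed.

Lemma in_Theta_mix c s th th' :
  0 <= s <= 1 -> inTh c th -> inTh c th' -> inTh c (mix s th th').
Proof.
move=> /andP[s0 s1] /and3P[/forallP a1 a2 a3] /and3P[/forallP b1 b2 b3].
have s1' : 0 <= 1 - s by lra.
apply/and3P; split.
- apply/forallP => f; rewrite ffunE.
  have /andP[? ?] := a1 f; have /andP[? ?] := b1 f; apply/andP; split.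
    by rewrite addr_ge0 ?mulr_ge0.
  have /le_trans -> // : (1 - s) * th f + s * th' f <= (1 - s) * 1 + s * 1.
    by rewrite lerD ?ler_wpM2l.
  by rewrite !mulr1 subrK.
- rewrite W_theta_mix mxE [X in _ <= X + _]mxE [X in _ <= _ + X]mxE.
  have -> : eps = (1 - s) * eps + s * eps by ring.
  by rewrite lerD ?ler_wpM2l.
- rewrite W_theta_mix; apply: le_trans (q_superadditive _ _); rewrite !qZ//.
  have -> : eps = (1 - s) * eps + s * eps by ring.
  by rewrite lerD ?ler_wpM2l.
Qed.

Lemma in_Theta0 c : inTh c [ffun => 0].
Proof.
have -> : inTh c [ffun => 0] = (eps <= step c 0 0) && (eps <= q (step c)).
  rewrite /in_Theta; have -> : Wth c [ffun => 0] = step c.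
    by rewrite /W_theta big1 ?addr0// => f _; rewrite ffunE scale0r.
  rewrite [X in [&& X, _ & _]](_ : _ = true)//.
  by apply/forallP => f; rewrite ffunE lexx ler01.
by have [-> ->] := eps_le c.
Qed.

Lemma in_Theta_scale c s th : 0 <= s <= 1 -> inTh c th ->
  inTh c (scale_theta s th).
Proof.
move=> s01 th_in; have := in_Theta_mix s01 (in_Theta0 c) th_in.
by congr (is_true (inTh c _)); apply/ffunP => f; rewrite !ffunE mulr0 add0r.
Qed.

Lemma Lambda0_ge0 c f : 0 <= La0 c f.
Proof.
rewrite /Lambda0; case: ifP => // _; rewrite le_min ler01 /= divr_ge0//.
  by rewrite subr_ge0; case: (eps_le c).
by rewrite addr_ge0 ?(ltW eps0_gt0)// sumr_ge0.
Qed.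

Lemma Lambda0_le1 c f : La0 c f <= 1.
Proof. by rewrite /Lambda0; case: ifP => // _; rewrite ge_min lexx. Qed.

(** Only negative corrections lower the first component. Their total effect is at least [- k * A]
    with [k * A] equal to the margin above [eps] times [A / (eps0 + A)], hence at most that
    margin. *)
Lemma W0_theta_ge c th : (forall f, 0 <= th f <= La0 c f) ->
  eps <= Wth c th 0 0.
Proof.
move=> th_le; rewrite /W_theta mxE summxE.
pose A := \sum_(mu | corr c mu 0 0 < 0) `|corr c mu 0 0|.
have A0 : 0 <= A by rewrite sumr_ge0.
have s0 : 0 <= step c 0 0 - eps by rewrite subr_ge0; case: (eps_le c).
pose k := (step c 0 0 - eps) / (eps0 + A).
have k0 : 0 <= k by rewrite divr_ge0// addr_ge0// ltW.
have kA : k * A <= step c 0 0 - eps.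
  rewrite /k mulrAC ler_pdivrMr ?ltr_wpDr// ler_wpM2l//.
  by rewrite lerDr ltW.
suff : - (k * A) <= \sum_i (th i *: corr c i) 0 0 by lra.
rewrite /A mulr_sumr -sumrN big_mkcond /=; apply: ler_sum => f _.
have /andP[t0 t1] := th_le f; rewrite mxE.
case: ifPn => [cneg|cpos]; last by rewrite mulr_ge0// leNgt.
rewrite ltr0_norm// mulrN opprK ler_wnM2r ?(ltW cneg)//.
by apply: le_trans t1 _; rewrite /Lambda0 cneg ge_min lexx orbT.
Qed.

(** The factor is 1 or [lam c v]. In the second case the bound on [q] is an equality, and the first
    component is controlled because scaling stays below [Lambda0]. *)
Lemma vertex_hatP c v : exists s,
  [/\ 0 <= s <= 1, hat c v = scale_theta s (vert c v) & inTh c (hat c v)].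
Proof.
rewrite /vertex_hat; case: ifPn => [vin|/lamP[/andP[l0 l1] ql]].
  exists 1; rewrite ler01 lexx; split=> //.
  by apply/ffunP => f; rewrite [RHS]ffunE mul1r.
exists (lam c v); rewrite l0 ltW//; split=> //.
have bnd f : 0 <= scale_theta (lam c v) (vert c v) f <= La0 c f.
  rewrite !ffunE; have L0 := Lambda0_ge0 c f; apply/andP; split.
    by rewrite !mulr_ge0.
  rewrite mulrA -[leRHS]mul1r ler_wpM2r// mulr_ile1// ?(ltW l1)//.
  by rewrite lern1 leq_b1.
apply/and3P; split; last by rewrite ql.
- apply/forallP => f; have /andP[-> H] /= := bnd f.
  by rewrite (le_trans H) ?Lambda0_le1.
- exact: W0_theta_ge.
Qed.

Lemma Lambda_le_hat c v f : v f -> La c f <= hat c v f.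
Proof.
by move=> vf; rewrite /Lambda; apply: bigmin_le_cond.
Qed.

Lemma Lambda_ge0 c f : 0 <= La c f.
Proof.
rewrite /Lambda; elim/big_ind: _ => [|x y x0 y0|v _]; first exact: ler01.
  by rewrite le_min x0.
have [s [/andP[s0 _] -> _]] := vertex_hatP c v.
by rewrite !ffunE !mulr_ge0 ?ler0n ?Lambda0_ge0.
Qed.

(* Writing [th f = y f * La0 c f], let [f0] maximize [y].  The scaled vertices
   [y f0 * vert c v] with [v f0] lie in Theta because Theta is star-shaped
   about 0, and [th] is a convex combination of them. *)
Lemma in_Theta_below_Lambda c th :
  (forall f, 0 <= th f <= La c f) -> inTh c th.
Proof.
move=> th_le.
pose y : {ffun face -> R} := [ffun f => th f / La0 c f].
have y0 f : 0 <= y f.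
  by rewrite ffunE divr_ge0 ?Lambda0_ge0//; case/andP: (th_le f).
(* Where [La0 c f = 0], the quotient [y f] is 0 by convention; [th f] vanishes as well, being
   bounded by the scaled all-ones vertex. *)
have thE : th = [ffun f => y f * La0 c f].
  apply/ffunP => f; rewrite !ffunE; have [L0|L0] := eqVneq (La0 c f) 0.
    rewrite L0 mulr0; apply/eqP; rewrite eq_le.
    have /andP[-> H] := th_le f; rewrite andbT; apply: le_trans H _.
    have /(Lambda_le_hat c) : [ffun => true] f by rewrite ffunE.
    have [s [_ -> _]] := vertex_hatP c [ffun => true].
    by rewrite !ffunE L0 !mulr0.
  by rewrite divfK.
have [f0 _ ymax] : exists2 f0, true & forall f, y f <= y f0.
  exists [arg max_(f > (ord0, true) : face) y f]%O => //.
  by move=> f; case: arg_maxP => // i _ Hi; apply: Hi.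
set s := y f0 in ymax *.
have [s0|s0] := eqVneq s 0.
  have -> : th = [ffun => 0].
    rewrite thE; apply/ffunP => f; rewrite [LHS]ffunE [RHS]ffunE.
    have -> : y f = 0; last by rewrite mul0r.
    by apply/eqP; rewrite eq_le y0 -s0 ymax.
  exact: in_Theta0.
have s_gt0 : 0 < s by rewrite lt_def s0 y0.
pose P (z : {ffun face -> R}) : Prop :=
  inTh c (scale_theta s [ffun f => z f * La0 c f]).
have -> : th = scale_theta s [ffun f => [ffun g => y g / s] f * La0 c f].
  rewrite thE; apply/ffunP => f; rewrite ffunE [RHS]ffunE [X in _ = _ * X]ffunE.
  by rewrite [[ffun g => _] f]ffunE mulrA mulrCA divff// mulr1.
apply: (@cube_convex _ _ P f0).
- move=> a z z' a01 Pz Pz'; have := in_Theta_mix a01 Pz Pz'.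
  congr (is_true (inTh c _)); apply/ffunP => f; rewrite !ffunE; ring.
- move=> v vf0; rewrite /P.
  have -> : [ffun f => [ffun g => (v g)%:R] f * La0 c f] = vert c v.
    by apply/ffunP => f; rewrite !ffunE.
  have [r [/andP[r0 r1] hatE hat_in]] := vertex_hatP c v.
  (* As [v f0] holds, [hat c v f0 = r * La0 c f0] bounds [La c f0], hence [th f0 = s * La0 c f0]. *)
  have sr : s <= r.
    have L0 : La0 c f0 != 0.
      by apply: contraNneq s0 => L0; rewrite /s ffunE L0 invr0 mulr0.
    rewrite /s ffunE ler_pdivrMr ?lt_def ?L0 ?Lambda0_ge0//.
    have /andP[_ /le_trans->//] := th_le f0.
    apply: le_trans (Lambda_le_hat c vf0) _.
    by rewrite hatE !ffunE vf0 mul1r.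
  have r_gt0 : 0 < r by exact: lt_le_trans sr.
  have -> : scale_theta s (vert c v) = scale_theta (s / r) (hat c v).
    by apply/ffunP => f; rewrite hatE !ffunE !mulrA divfK// gt_eqF.
  apply: in_Theta_scale => //; rewrite divr_ge0 ?(ltW s_gt0) ?(ltW r_gt0)//=.
  by rewrite ler_pdivrMr// mul1r.
- by rewrite ffunE divff.
- by move=> f; rewrite ffunE divr_ge0 ?(ltW s_gt0)//= ler_pdivrMr// mul1r.
Qed.

(** Each interface parameter is a minimum over its two adjacent points, so the six parameters seen
    from [c] lie in the box of [c]. The lower interface of [c] in direction [l] is the upper one of
    [c - unit_ix l]. *)
Lemma limited_step_in_Theta c :
  let th : {ffun face -> R} := [ffun f : face =>
    limiter_theta dt dx w src high LF eps eps0 lam f.1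
      (if f.2 then c else c - unit_ix f.1)] in
  inTh c th /\
  Wth c th = w c + dt *: L_op dx src (limited_flux
    (limiter_theta dt dx w src high LF eps eps0 lam) high LF) c.
Proof.
move=> th; split.
  apply: in_Theta_below_Lambda => -[l b]; rewrite ffunE /= /limiter_theta.
  rewrite le_min !Lambda_ge0 /=; case: b; rewrite ge_min ?lexx//.
  by rewrite subrK lexx orbT.
rewrite /W_theta /LF_step -addrA; congr (_ + _).
rewrite /L_op !scalerDr -addrA; congr (_ + _).
have -> : \sum_f th f *: corr c f = \sum_l \sum_b th (l, b) *: corr c (l, b).
  by rewrite pair_bigA; apply: eq_bigr => -[].
rewrite !scaler_sumr -big_split /=; apply: eq_bigr => l _.
rewrite big_bool /th !ffunE /= /limited_flux.
set t1 := limiter_theta _ _ _ _ _ _ _ _ _ _ _.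
set t2 := limiter_theta _ _ _ _ _ _ _ _ _ _ _.
apply/colP => i; rewrite !mxE; ring.
Qed.
End Limiter.

(** * Equation of state *)

Section Eos.
Context {R : realType} (e : R -> R -> R).
Hypothesis he : eos_admissible e.
Implicit Types p rho : R.
Local Notation h := (enthalpy e).

Lemma enthalpy_derivable_rho p rho : 0 < p -> 0 < rho -> derivable (h p) rho 1.
Proof.
move=> p0 r0; have [_ ed _ _] := eos_C1 he p0 r0.
have rn : rho != 0 by rewrite gt_eqF.
have dV : derivable (fun r : R => r^-1) rho 1.
  by apply: derivableV; [exact: rn|exact: derivable_id].
exact: (derivableD (derivableD (derivable_cst (1 : R) _ _) ed)
                   (derivableM (derivable_cst p _ _) dV)).
Qed.

Lemma enthalpy_derivable_p p rho : 0 < p -> 0 < rho -> derivable (h^~ rho) p 1.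
Proof.
move=> p0 r0; have [ed _ _ _] := eos_C1 he p0 r0.
have d1 : derivable ((cst 1 : R -> R) + e^~ rho) p 1.
  exact: derivableD (derivable_cst (1 : R) _ _) ed.
have d2 : derivable ((id : R -> R) * cst rho^-1) p 1.
  by apply: derivableM; [exact: derivable_id|exact: derivable_cst].
exact: (derivableD d1 d2).
Qed.

Lemma enthalpy_continuous_rho p rho : 0 < p -> 0 < rho ->
  h p r @[r --> rho] --> h p rho.
Proof.
move=> p0 r0; apply: differentiable_continuous; apply/derivable1_diffP.
exact: enthalpy_derivable_rho.
Qed.

Lemma enthalpy_continuous_p p rho : 0 < p -> 0 < rho ->
  h r rho @[r --> p] --> h p rho.
Proof.
move=> p0 r0; apply: (@differentiable_continuous _ _ _ p (h^~ rho)).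
apply/derivable1_diffP.
exact: enthalpy_derivable_p.
Qed.

Lemma enthalpy_decr p rho rho' : 0 < p -> 0 < rho -> rho <= rho' ->
  h p rho' <= h p rho.
Proof.
move=> p0 r0; rewrite le_eqVlt => /predU1P[->//|rr'].
have in0 r : rho <= r -> 0 < r by exact: lt_le_trans.
apply/ltW/(@ltr0_derive1_decr _ (h p) rho rho') => //.
- move=> r; rewrite in_itv /= => /andP[/ltW/in0 ? _].
  exact: enthalpy_derivable_rho.
- move=> r; rewrite in_itv /= => /andP[/ltW/in0 r'0 _].
  by have /andP[_] := eos_d_enthalpy he p0 r'0.
- apply: derivable_within_continuous => r.
  rewrite in_itv /= => /andP[/in0 ? _]; exact: enthalpy_derivable_rho.
Qed.

(* The monotonicity in rho upgrades separate to joint continuity. *)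
Lemma enthalpy_continuous_along (r : R -> R) p : 0 < p -> 0 < r p ->
  {for p, continuous r} -> {for p, continuous (fun s => h s (r s))}.
Proof.
move=> p0 rp0 rc; apply/cvgrPdist_lt => eps eps0.
have e2 : 0 < eps / 2 by rewrite divr_gt0.
have /cvgrPdist_lt/(_ _ e2)/nbhs_ballP[d /= d0 hd] :=
  enthalpy_continuous_rho p0 rp0.
have m0 : 0 < Num.min d (r p) by rewrite lt_min d0.
(* [d' < d] gives continuity in the density at [r p - d'] and [r p + d'], and [d' < r p] keeps both
   positive. For [s] near [p], [h s (r s)] is squeezed between the values of [h s] at these two
   fixed densities. *)
have [d' [d'0 d'd d'r]] : exists d', [/\ 0 < d', d' < d & d' < r p].
  have md : Num.min d (r p) <= d by rewrite ge_min lexx.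
  have mr : Num.min d (r p) <= r p by rewrite ge_min lexx orbT.
  move: (Num.min _ _) m0 md mr => m *.
  by exists (m / 2); split; lra.
have h1 : `|h p (r p) - h p (r p - d')| < eps / 2.
  by apply: hd; rewrite /ball /= opprB addrC subrK ger0_norm// ltW.
have h2 : `|h p (r p) - h p (r p + d')| < eps / 2.
  by apply: hd; rewrite /ball /= opprD addrA subrr sub0r normrN ger0_norm// ltW.
have rm0 : 0 < r p - d' by lra.
have rp0' : 0 < r p + d' by lra.
near=> s.
have s0 : 0 < s by near: s; exact: lt_nbhsr.
have h3 : `|h p (r p - d') - h s (r p - d')| < eps / 2.
  by near: s; have /cvgrPdist_lt/(_ _ e2) := enthalpy_continuous_p p0 rm0.
have h4 : `|h p (r p + d') - h s (r p + d')| < eps / 2.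
  by near: s; have /cvgrPdist_lt/(_ _ e2) := enthalpy_continuous_p p0 rp0'.
have h5 : `|r p - r s| < d'.
  by near: s; move/cvgrPdist_lt : rc; exact.
have /andP[r1 r2] : r p - d' < r s < r p + d' by rewrite -ltr_distl distrC.
have rs0 : 0 < r s by exact: lt_trans r1.
have u : h s (r s) <= h s (r p - d') by apply: enthalpy_decr (ltW r1).
have l : h s (r p + d') <= h s (r s) by apply: enthalpy_decr (ltW r2).
move: h1 h2 h3 h4; rewrite !ltr_norml.
by move=> /andP[? ?] /andP[? ?] /andP[? ?] /andP[? ?]; apply/andP; split; lra.
Unshelve. all: by end_near. Qed.

(** With tau = p / rho, the first bound is the square of h - tau >= sqrt(1 + tau^2); the second
    follows from sqrt(1 + tau^2) > tau. *)
Lemma enthalpy_bound p rho : 0 < p -> 0 < rho ->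
  1 + 2 * (p / rho) * h p rho <= h p rho ^+ 2 /\ 2 * (p / rho) < h p rho.
Proof.
move=> p0 r0; have := eos_enthalpy_ge he p0 r0.
set tau := p / rho; rewrite -expr_div_n -/tau.
have t0 : 0 < tau by rewrite divr_gt0.
have t2 : 0 <= 1 + tau ^+ 2 by rewrite addr_ge0 ?sqr_ge0.
have : tau < Num.sqrt (1 + tau ^+ 2).
  by rewrite -[ltLHS]ger0_norm ?ltW// -sqrtr_sqr ltr_sqrt; lra || nra.
have := sqr_sqrtr t2; move: (Num.sqrt _) (h _ _) => a b; nra.
Qed.

Lemma energy_gt0 p rho : 0 < p -> 0 < rho -> 0 < e p rho.
Proof.
move=> p0 r0; have := eos_enthalpy_ge he p0 r0; rewrite /enthalpy lerD2r.
rewrite -expr_div_n; have : 0 < p / rho by rewrite divr_gt0.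
move: (p / rho) => tau t0.
suff : 1 < Num.sqrt (1 + tau ^+ 2) by lra.
have t20 : 0 < tau ^+ 2 by rewrite exprn_gt0.
by rewrite -[ltLHS]sqrtr1 ltr_sqrt; lra.
Qed.

(* With rho = D sigma and sigma = kappa / (E + p), the equation says
   rho h w = E + p for the Lorentz factor w = 1 / sigma. *)
Lemma pressure_exists (D M2 E : R) : 0 < D -> 0 <= M2 -> 0 < E ->
  D ^+ 2 + M2 < E ^+ 2 ->
  exists2 p, 0 < p &
    let kappa := Num.sqrt ((E + p) ^+ 2 - M2) in
    D * h p (D * (kappa / (E + p))) = kappa.
Proof.
move=> D0 M0 E0 DME.
pose kappa p := Num.sqrt ((E + p) ^+ 2 - M2).
pose sigma p := kappa p / (E + p).
pose Phi p := D * h p (D * sigma p) - kappa p.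
have Ep p : 0 <= p -> 0 < E + p by move=> ?; rewrite ltr_wpDr.
have rad p : 0 <= p -> D ^+ 2 < (E + p) ^+ 2 - M2 by move=> ?; nra.
have radgt0 p : 0 <= p -> 0 < (E + p) ^+ 2 - M2.
  by move=> /rad; apply: lt_trans; rewrite exprn_gt0.
have radge0 p : 0 <= p -> 0 <= (E + p) ^+ 2 - M2 by move=> /radgt0/ltW.
have kgt p : 0 <= p -> D < kappa p.
  by move=> p0; rewrite -[D]gtr0_norm// -sqrtr_sqr ltr_sqrt ?radgt0 ?rad.
have kgt0 p : 0 <= p -> 0 < kappa p by move=> /kgt; exact: lt_trans.
have kle p : 0 <= p -> kappa p <= E + p.
  move=> p0; rewrite -[leRHS]gtr0_norm ?Ep// -sqrtr_sqr ler_wsqrtr//.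
  by rewrite lerBlDr lerDl.
have sgt0 p : 0 <= p -> 0 < sigma p by move=> ?; rewrite divr_gt0 ?kgt0 ?Ep.
have sle1 p : 0 <= p -> sigma p <= 1.
  by move=> ?; rewrite /sigma ler_pdivrMr ?Ep// mul1r kle.
have sge p : 0 <= p -> sigma 0 <= sigma p.
  move=> p0; rewrite -(ler_pXn2r (_ : 0 < 2)%N) ?nnegrE ?(ltW (sgt0 _ _))//.
  rewrite /sigma !expr_div_n !sqr_sqrtr ?radge0// addr0.
  rewrite ler_pdivrMr ?exprn_gt0// mulrAC ler_pdivlMr ?exprn_gt0 ?Ep//.
  have : 0 <= M2 * (p * (2 * E + p)).
    by rewrite !mulr_ge0 ?addr_ge0 ?mulr_ge0 ?(ltW E0).
  by nra.
have kge p : 0 <= p -> kappa 0 <= kappa p.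
  by move=> p0; rewrite ler_sqrt ?radgt0//; nra.
have Ds0 : 0 < D * sigma 0 by rewrite mulr_gt0 ?sgt0.
(* Since [sigma 0 <= sigma p] and [h] decreases in the density, the density can be frozen at
   [D * sigma 0], where [h] tends to 1 as p tends to 0. Half of the gap [kappa 0 - D] is spent on
   [e] and half on p / rho. *)
have [p1 p1_gt0 Phi1] : exists2 p, 0 < p & Phi p < 0.
  have d0 : 0 < (kappa 0 - D) / (2 * D).
    by rewrite divr_gt0 ?mulr_gt0// subr_gt0 kgt.
  have ds0 : 0 < D * sigma 0 * ((kappa 0 - D) / (2 * D)) by rewrite mulr_gt0.
  have /cvgrPdist_lt/(_ _ d0) near_e := eos_lim0 he Ds0.
  near (0 : R)^'+ => p.
  have p0 : 0 < p by near: p; exact: nbhs_right_gt.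
  have e1 : e p (D * sigma 0) < (kappa 0 - D) / (2 * D).
    have : `|0 - e p (D * sigma 0)| < (kappa 0 - D) / (2 * D) by near: p.
    by rewrite sub0r normrN => /(le_lt_trans (ler_norm _)).
  have e2 : p / (D * sigma 0) < (kappa 0 - D) / (2 * D).
    rewrite ltr_pdivrMr// mulrC; near: p; exact: nbhs_right_lt.
  exists p => //; rewrite /Phi subr_lt0.
  have /le_lt_trans-> // : D * h p (D * sigma p) <= D * h p (D * sigma 0).
    by rewrite ler_pM2l// enthalpy_decr// ler_pM2l// sge// ltW.
  apply: lt_le_trans (kge _ (ltW p0)).
  have -> : kappa 0 = D * (1 + (kappa 0 - D) / (2 * D) + (kappa 0 - D) / (2 * D)).
    by field; rewrite gt_eqF.
  by rewrite ltr_pM2l// /enthalpy ltrD// ltrD2l.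
(* Here [sigma p <= 1] allows freezing the density at [D]; once [e p D >= E / D], one has D h >= D +
   E + p > [kappa p]. *)
have [p2 p12 Phi2] : exists2 p, p1 <= p & 0 < Phi p.
  have /cvgryPge/(_ (E / D)) near_e := eos_limy he D0.
  near +oo_R => p.
  have pp1 : p1 <= p by near: p; apply: nbhs_pinfty_ge; exact: num_real.
  have p0 : 0 < p by exact: lt_le_trans pp1.
  have e1 : E / D <= e p D by near: p.
  exists p => //; rewrite /Phi subr_gt0.
  apply: le_lt_trans (kle _ (ltW p0)) _.
  have /(lt_le_trans _)-> // : D * h p D <= D * h p (D * sigma p).
    rewrite ler_pM2l//; apply: enthalpy_decr => //.
      by rewrite mulr_gt0// sgt0// ltW.
    by rewrite ger_pMr// sle1// ltW.
  rewrite /enthalpy !mulrDr mulr1 (mulrC D (p / D)) divfK ?gt_eqF//.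
  by move: e1; rewrite ler_pdivrMr// mulrC => ?; lra.
have kc p : 0 < p -> {for p, continuous kappa}.
  move=> p0; apply: continuous_comp; last exact: sqrt_continuous.
  by apply: cvgB; [|exact: cvg_cst];
    apply: (@continuous_comp _ _ _ (fun x => E + x) (fun y => y ^+ 2));
    [apply: cvgD; [exact: cvg_cst|exact: cvg_id]|exact: exprn_continuous].
have Phic : {within `[p1, p2], continuous Phi}.
  apply: continuous_in_subspaceT => p; rewrite inE /= in_itv /= => /andP[pp1 _].
  have p0 : 0 < p by exact: lt_le_trans pp1.
  apply: cvgB; last exact: kc.
  apply: cvgM; first exact: cvg_cst.
  apply: (@enthalpy_continuous_along (fun s => D * sigma s)) => //.
    by rewrite mulr_gt0// sgt0// ltW.
  apply: cvgM; first exact: cvg_cst.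
  apply: cvgM; first exact: kc.
  apply: cvgV; first by rewrite gt_eqF// Ep// ltW.
  by apply: cvgD; [exact: cvg_cst|exact: cvg_id].
have [|p] := IVT p12 Phic (v := 0).
  by rewrite ge_min (ltW Phi1) le_max (ltW Phi2) orbT.
rewrite in_itv /= => /andP[pp1 _] /eqP; rewrite subr_eq0 => /eqP Phip.
by exists p => //; exact: lt_le_trans pp1.
Unshelve. all: by end_near. Qed.

(** These two relations are all that the acoustic estimate uses of the ideal law. The closed form of
    [h] holds only for positive arguments, so it is differentiated through equality on a
    neighbourhood. *)
Lemma ideal_sound_speed : ideal_eos e -> exists2 Gam : R, 1 < Gam <= 2 &
  forall p rho, 0 < p -> 0 < rho ->
  Gam * (p / rho) = (Gam - 1) * (h p rho - 1) /\
  sound_speed e p rho ^+ 2 = Gam * (p / rho) / h p rho.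
Proof.
move=> [Gam /andP[G1 G2] hE]; exists Gam; first by rewrite G1.
move=> p rho p0 r0.
have hgt0 : 0 < h p rho.
  have [_] := enthalpy_bound p0 r0; apply: lt_trans.
  by rewrite mulr_gt0// divr_gt0.
have G0 : Gam - 1 != 0 by rewrite gt_eqF// subr_gt0.
have r0' : rho != 0 by rewrite gt_eqF.
have dr : d_rho h p rho = - (Gam * p / (Gam - 1)) / rho ^+ 2.
  pose k : R := Gam * p / (Gam - 1).
  have near_h : \forall r \near rho, 1 + k / r = h p r.
    near=> r; have r1 : 0 < r by near: r; exact: lt_nbhsr.
    by rewrite hE// /k; field; rewrite G0 gt_eqF.
  have dV : is_derive rho (1 : R) (fun r : R => r^-1) _ :=
    is_deriveV r0' (is_derive_id _ _).
  have [_] := near_eq_is_derive near_h (is_deriveD (is_derive_cst (1 : R) rho 1)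
                 (is_deriveM (is_derive_cst k rho 1) dV)).
  rewrite /d_rho derive1E => ->; rewrite /GRing.scale /= /k; field.
  by rewrite G0 r0'.
have dp : d_p h p rho = Gam / ((Gam - 1) * rho).
  pose k : R := Gam / ((Gam - 1) * rho).
  have near_h : \forall s \near p, 1 + s * k = h s rho.
    near=> s; have s0 : 0 < s by near: s; exact: lt_nbhsr.
    by rewrite hE// /k; field; rewrite G0 r0'.
  have [_] := near_eq_is_derive near_h (is_deriveD (is_derive_cst (1 : R) p 1)
                 (is_deriveM (is_derive_id p 1) (is_derive_cst k p 1))).
  rewrite /d_p derive1E => ->; rewrite /GRing.scale /=.
  by rewrite mulr0 !add0r mulr1.
have c2E : sound_speed2 e p rho = Gam * (p / rho) / h p rho.
  rewrite /sound_speed2 dr dp.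
  have -> : rho^-1 - Gam / ((Gam - 1) * rho) = - ((Gam - 1) * rho)^-1.
    by field; rewrite G0 r0'.
  by field; rewrite (gt_eqF hgt0) G0 r0'.
split; first by rewrite hE//; field; rewrite G0 r0'.
have Gam0 : 0 < Gam by exact: lt_trans G1.
by rewrite sqr_sqrtr ?c2E// divr_ge0 ?mulr_ge0 ?invr_ge0 ?ltW.
Unshelve. all: by end_near. Qed.
End Eos.

(** * Lax-Friedrichs splitting in the orthonormal frame *)

Section State5.
Context {R : realType}.
Implicit Types (d E k : R) (m u v : 'cV[R]_3) (U : 'cV[R]_5).

Definition dotv u v : R := \sum_i u i 0 * v i 0.
Definition sqn u : R := \sum_i u i 0 ^+ 2.

Lemma sqn_ge0 u : 0 <= sqn u.
Proof. by apply: sumr_ge0 => i _; exact: sqr_ge0. Qed.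

Lemma sqnE u : sqn u = (u^T *m u) 0 0.
Proof. by rewrite mxE; apply: eq_bigr => i _; rewrite mxE expr2. Qed.

Lemma dotvE u v : dotv u v = (u^T *m v) 0 0.
Proof. by rewrite mxE; apply: eq_bigr => i _; rewrite mxE. Qed.

Lemma dotv_sqr_le u v : dotv u v ^+ 2 <= sqn u * sqn v.
Proof. exact: sum_cauchy_schwarz. Qed.

Lemma sqn_comb k u d v :
  sqn (k *: u + d *: v) = k ^+ 2 * sqn u + 2 * k * d * dotv v u + d ^+ 2 * sqn v.
Proof.
rewrite /sqn /dotv !mulr_sumr -!big_split /=; apply: eq_bigr => i _.
rewrite !mxE; ring.
Qed.

Lemma sqnZ k u : sqn (k *: u) = k ^+ 2 * sqn u.
Proof. by rewrite /sqn mulr_sumr; apply: eq_bigr => i _; rewrite mxE exprMn. Qed.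

Lemma state5Z k d m E : k *: state5 d m E = state5 (k * d) (k *: m) (k * E).
Proof.
rewrite /state5 (@scale_col_mx _ 1 4 1) (@scale_col_mx _ 3 1 1).
by rewrite !scale_scalar_mx.
Qed.

Lemma state5D d m E d' m' E' :
  state5 d m E + state5 d' m' E' = state5 (d + d') (m + m') (E + E').
Proof. by rewrite /state5 (@add_col_mx _ 1 4 1) (@add_col_mx _ 3 1 1) -!raddfD. Qed.

Lemma state5_0 d m E : state5 d m E 0 0 = d.
Proof.
have -> : 0 = lshift 4 (0 : 'I_1) :> 'I_5 by apply: val_inj.
by rewrite /state5 (col_mxEu (d%:M : 'cV_1)) mxE.
Qed.

Lemma state5_mid d m E (i : 'I_3) : state5 d m E (rshift 1 (lshift 1 i)) 0 = m i 0.
Proof. by rewrite /state5 (col_mxEd (d%:M : 'cV_1)) (col_mxEu m). Qed.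

Lemma state5_max d m E : state5 d m E ord_max 0 = E.
Proof.
have -> : ord_max = rshift 1 (rshift 3 (0 : 'I_1)) :> 'I_5 by apply: val_inj.
by rewrite /state5 (col_mxEd (d%:M : 'cV_1)) (col_mxEd m) mxE.
Qed.

Lemma state5_surj U : exists d m E, U = state5 d m E.
Proof.
pose V : 'cV[R]_(3 + 1) := dsubmx (U : 'cV_(1 + 4)).
exists (usubmx (U : 'cV_(1 + 4)) 0 0), (usubmx V), (dsubmx V 0 0).
by rewrite /state5 -!mx11_scalar !vsubmxK.
Qed.

Lemma q_state5 d m E : q (state5 d m E) = E - Num.sqrt (d ^+ 2 + sqn m).
Proof.
rewrite /q state5_max big_mkcond big_ord_recr /= addr0 big_ord_recl /=.
congr (_ - Num.sqrt (_ + _)).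
  by rewrite -[in RHS](state5_0 d m E); congr (state5 d m E _ 0 ^+ 2);
    apply: val_inj.
apply: eq_bigr => i _; rewrite ifT; last first.
  apply/eqP => /(congr1 val) /=; rewrite /bump leq0n add1n => -[H].
  by have := ltn_ord i; rewrite H.
by rewrite -[in RHS](state5_mid d m E); congr (state5 d m E _ 0 ^+ 2);
    apply: val_inj.
Qed.
End State5.

Section Splitting.
Context {R : realType}.
Implicit Types (D B p k s : R) (n nu : 'cV[R]_3).

(* The energy component [f s = s (B - p) + k B] is affine in [s], and the
   quadratic condition keeps it away from 0, so it cannot change sign. *)
Lemma split_cone D B p s0 n nu (k := dotv n nu)
    (A := (B - p) ^+ 2 - D ^+ 2 - B ^+ 2 * sqn nu - p ^+ 2) :
  0 < D -> 0 < p -> p < B -> 0 <= s0 ->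
  (forall s, s0 <= s ->
     0 <= s + k /\ 0 <= (s + k) ^+ 2 * A + p ^+ 2 * (s ^+ 2 - sqn n)) ->
  forall s, s0 <= s ->
  Gbar (s *: state5 D (B *: nu) (B - p) +
        (k *: state5 D (B *: nu) (B - p) + p *: state5 0 n k)).
Proof.
move=> D0 p0 pB s00 cond s ss0.
pose Q t := sqn (((t + k) * B) *: nu + p *: n).
(* Squared energy component = squared density component + squared momentum + the quadratic
   condition. *)
have QE t : (t * (B - p) + k * B) ^+ 2 =
    ((t + k) * D) ^+ 2 + Q t + ((t + k) ^+ 2 * A + p ^+ 2 * (t ^+ 2 - sqn n)).
  by rewrite /Q sqn_comb -/k /A; ring.
have Q0 t : 0 <= Q t by exact: sqn_ge0.
have f0 : 0 <= s * (B - p) + k * B.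
  rewrite leNgt; apply/negP => fneg.
  have B0 : 0 < B by exact: lt_trans pB.
  have E0 : 0 < B - p by rewrite subr_gt0.
  have kneg : k < 0.
    rewrite ltNge; apply/negP => k0; move: fneg; rewrite ltNge.
    by rewrite addr_ge0// mulr_ge0 ?(ltW E0) ?(ltW B0)// (le_trans s00).
  (* The zero of the energy component. It exceeds [s] because the component is negative at [s], and
     [k < 0] makes [t + k] positive, so the density term in [QE t] contradicts a zero left side. *)
  pose t := - k * B / (B - p).
  have ts : s0 <= t.
    by apply: le_trans ss0 _; rewrite ler_pdivlMr//; lra.
  have [_ c2] := cond _ ts.
  have tE : t * (B - p) = - k * B by rewrite divfK// gt_eqF.
  have := QE t; rewrite tE mulNr addNr expr0n /= => H.
  have tk : t + k = - k * p / (B - p) by rewrite /t; field; rewrite gt_eqF.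
  have : 0 < ((t + k) * D) ^+ 2.
    by rewrite tk exprn_gt0// !mulr_gt0 ?invr_gt0 ?oppr_gt0.
  have := Q0 t; lra.
have [sk0 c2] := cond _ ss0.
rewrite addrA -scalerDl !state5Z state5D !scalerA mulr0 addr0; split.
  by rewrite state5_0 mulr_ge0// ltW.
rewrite q_state5 subr_ge0.
have -> : (s + k) * (B - p) + p * k = s * (B - p) + k * B by ring.
rewrite -[leRHS]ger0_norm// -sqrtr_sqr ler_wsqrtr// QE -/(Q s).
by rewrite lerDl.
Qed.

Section Speeds.
Variables (rho h p w : R) (n nu : 'cV[R]_3).
Hypotheses (rho0 : 0 < rho) (p0 : 0 < p) (h0 : 0 < h).
Hypotheses (nu1 : sqn nu < 1) (w0 : 0 < w) (wE : w ^+ 2 * (1 - sqn nu) = 1).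
Hypothesis hb : 1 + 2 * (p / rho) * h <= h ^+ 2.
Hypothesis hb' : 2 * (p / rho) < h.
Let B := rho * h * w ^+ 2.
Let D := rho * w.
Let k := dotv n nu.
Let A := (B - p) ^+ 2 - D ^+ 2 - B ^+ 2 * sqn nu - p ^+ 2.

(** [A] is B^2 (1 - |nu|^2) - 2 p B - D^2, and one factor w^2 is absorbed by w^2 (1 - |nu|^2) =
    1. *)
Lemma split_energyE :
  A = rho ^+ 2 * w ^+ 2 * (h ^+ 2 - 1 - 2 * (p / rho) * h).
Proof.
have -> : A = rho ^+ 2 * h ^+ 2 * w ^+ 2 * (w ^+ 2 * (1 - sqn nu))
   - 2 * p * rho * h * w ^+ 2 - rho ^+ 2 * w ^+ 2 by rewrite /A /B /D; ring.
by rewrite wE; field; rewrite gt_eqF.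
Qed.

Lemma split_energy_ge0 : 0 <= A.
Proof.
rewrite split_energyE; apply: mulr_ge0; first by rewrite mulr_ge0 ?sqr_ge0.
by rewrite -addrA -opprD subr_ge0.
Qed.

Lemma pressure_lt : p < B.
Proof.
have w1 : 1 <= w ^+ 2.
  have := sqn_ge0 nu; have : 0 < w ^+ 2 by rewrite exprn_gt0.
  move: wE; nra.
move: hb'; rewrite mulrA ltr_pdivrMr// => ?.
have : 0 < rho * h by rewrite mulr_gt0.
rewrite /B; nra.
Qed.

Lemma dotv_sqr_le_sqn : k ^+ 2 <= sqn n.
Proof.
apply: le_trans (dotv_sqr_le n nu) _.
by rewrite ler_piMr ?sqn_ge0// ltW.
Qed.

(** With s >= |n| both summands of the quadratic condition are nonnegative separately, and |k| <=
    |n| by Cauchy-Schwarz and |nu| < 1. *)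
Lemma split_general s : Num.sqrt (sqn n) <= s ->
  Gbar (s *: state5 D (B *: nu) (B - p) +
        (k *: state5 D (B *: nu) (B - p) + p *: state5 0 n k)).
Proof.
apply: split_cone; rewrite ?sqrtr_ge0 ?mulr_gt0 ?pressure_lt// => t tn.
have t0 : 0 <= t by apply: le_trans tn; exact: sqrtr_ge0.
have n2 : sqn n <= t ^+ 2.
  by rewrite -(sqr_sqrtr (sqn_ge0 n)) ler_pXn2r// nnegrE sqrtr_ge0.
split.
  suff : `|k| <= t by rewrite ler_norml /k => /andP[? _]; lra.
  apply: le_trans tn; rewrite -sqrtr_sqr ler_wsqrtr//; exact: dotv_sqr_le_sqn.
by rewrite addr_ge0// mulr_ge0 ?sqr_ge0 ?split_energy_ge0// subr_ge0.
Qed.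

(* The lower bound on [s] is the larger root [l] of the acoustic equation
   w^2 (1 - c^2) (l - |k|)^2 = c^2 (sqn n - l^2), so that at [l] the quadratic
   condition of [split_cone] becomes p^2 w^2 (1 - c^2) <= A c^2. *)
Lemma split_ideal (Gam c s : R) : 1 < Gam <= 2 ->
  Gam * (p / rho) = (Gam - 1) * (h - 1) ->
  0 <= c -> c ^+ 2 = Gam * (p / rho) / h ->
  (1 - sqn nu * c ^+ 2)^-1 *
     (`|k| * (1 - c ^+ 2) +
      c * w^-1 *
        Num.sqrt ((1 - sqn nu * c ^+ 2) * sqn n - (1 - c ^+ 2) * k ^+ 2)) <= s ->
  Gbar (s *: state5 D (B *: nu) (B - p) +
        (k *: state5 D (B *: nu) (B - p) + p *: state5 0 n k)).
Proof.
move=> /andP[G1 G2] Gtau c_ge0 c2E.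
set L := 1 - _; set K := `|k|; set S2 := L * sqn n - _; set l := L^-1 * _.
have K2 : k ^+ 2 = K ^+ 2 by rewrite real_normK// num_real.
have Kn : K ^+ 2 <= sqn n by rewrite -K2 dotv_sqr_le_sqn.
have K0 : 0 <= K by exact: normr_ge0.
have v0 := sqn_ge0 nu; have n0 := sqn_ge0 n.
have tau0 : 0 < p / rho by rewrite divr_gt0.
have Gm0 : 0 < Gam - 1 by rewrite subr_gt0.
have Gam0 : 0 < Gam by exact: lt_trans G1.
have h1 : 1 < h by rewrite -subr_gt0 -(pmulr_rgt0 _ Gm0) -Gtau mulr_gt0.
have c2h : c ^+ 2 * h = (Gam - 1) * (h - 1) by rewrite c2E Gtau divfK ?gt_eqF.
have c20 : 0 < c ^+ 2 by rewrite c2E !mulr_gt0 ?invr_gt0.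
have c21 : c ^+ 2 < 1.
  rewrite -(ltr_pM2r h0) c2h mul1r.
  have : (Gam - 1) * (h - 1) <= 1 * (h - 1) by rewrite ler_wpM2r//; lra.
  lra.
have L0 : 0 < L by rewrite subr_gt0 mulr_ilt1// ltW.
have S20 : 0 <= S2.
  have -> : S2 = L * (sqn n - K ^+ 2) + K ^+ 2 * (c ^+ 2 * (1 - sqn nu)).
    by rewrite /S2 K2 /L; ring.
  apply: addr_ge0; apply: mulr_ge0; rewrite ?(ltW L0) ?subr_ge0 ?sqr_ge0//.
  by rewrite mulr_ge0 ?subr_ge0 ?(ltW c20) ?(ltW nu1).
pose u := c * w^-1 * Num.sqrt S2.
have wV : w^-1 ^+ 2 = 1 - sqn nu.
  have w2n : w ^+ 2 != 0 by rewrite gt_eqF ?exprn_gt0.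
  by apply: (mulfI w2n); rewrite exprVn divff// wE.
have u0 : 0 <= u by rewrite !mulr_ge0 ?invr_ge0 ?sqrtr_ge0// ltW.
have u2 : u ^+ 2 = c ^+ 2 * (1 - sqn nu) * S2.
  by rewrite /u !exprMn wV sqr_sqrtr.
have lL : L * l = K * (1 - c ^+ 2) + u by rewrite /l mulVKf// gt_eqF.
(* Since L - (1 - c^2) = c^2 (1 - |nu|^2), the claim compares [u] with K c^2 (1 - |nu|^2), which is
   done on squares. *)
have Kl : K <= l.
  rewrite -(ler_pM2l L0) lL.
  suff : K * (c ^+ 2 * (1 - sqn nu)) <= u by rewrite /L; lra.
  rewrite -(@ler_pXn2r _ 2)// ?nnegrE// ?mulr_ge0 ?subr_ge0 ?(ltW c20) ?(ltW nu1)//.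
  rewrite u2 -subr_ge0.
  have -> : c ^+ 2 * (1 - sqn nu) * S2 - (K * (c ^+ 2 * (1 - sqn nu))) ^+ 2 =
     c ^+ 2 * (1 - sqn nu) * (L * (sqn n - K ^+ 2)).
    by rewrite /S2 K2 /L; ring.
  apply: mulr_ge0; first by rewrite mulr_ge0 ?subr_ge0 ?(ltW c20) ?(ltW nu1).
  by apply: mulr_ge0; rewrite ?(ltW L0) ?subr_ge0.
have l0 : 0 <= l by exact: le_trans Kl.
(* As a quadratic in [l] this has leading coefficient [L]; multiplying by [L] completes the
   square. *)
have root_l : (1 - c ^+ 2) * (l - K) ^+ 2 = c ^+ 2 * (1 - sqn nu) * (sqn n - l ^+ 2).
  apply: (mulfI (negbT (gt_eqF L0))).
  apply/eqP; rewrite -subr_eq0; apply/eqP.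
  transitivity ((L * l - (1 - c ^+ 2) * K) ^+ 2 - c ^+ 2 * (1 - sqn nu) * S2).
    by rewrite /S2 K2 /L; ring.
  by rewrite lL -u2; ring.
have Ac : p ^+ 2 * w ^+ 2 * (1 - c ^+ 2) <= A * c ^+ 2.
  have -> : A * c ^+ 2 = rho ^+ 2 * w ^+ 2 *
      (c ^+ 2 * (h ^+ 2 - 1 - 2 * (p / rho) * h)).
    by rewrite split_energyE; ring.
  have -> : p ^+ 2 * w ^+ 2 * (1 - c ^+ 2) =
      rho ^+ 2 * w ^+ 2 * ((p / rho) ^+ 2 * (1 - c ^+ 2)).
    by field; rewrite gt_eqF.
  apply: ler_wpM2l; first by rewrite mulr_ge0 ?sqr_ge0.
  rewrite -(ler_pM2r h0).
  have -> : (p / rho) ^+ 2 * (1 - c ^+ 2) * h =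
    (p / rho) ^+ 2 * (h - c ^+ 2 * h) by ring.
  rewrite (mulrAC (c ^+ 2)) c2h -Gtau.
  rewrite -subr_ge0; move: (p / rho) tau0 Gtau => tau tau0 Gtau.
  have tauE : tau = (Gam - 1) * (h - 1) / Gam.
    by rewrite -Gtau mulrC mulKf// gt_eqF.
  (* Eliminating tau by [tauE] factors the difference; [Gam <= 2] makes the last factor
     nonnegative. *)
  have -> : Gam * tau * (h ^+ 2 - 1 - 2 * tau * h) -
     tau ^+ 2 * (h - Gam * tau) =
     tau * (h - 1) / Gam * (h * (2 - Gam) + (2 * Gam - 1)).
    by rewrite tauE; field; rewrite gt_eqF.
  have hG : 0 <= h * (2 - Gam) by rewrite mulr_ge0 ?subr_ge0 ?(ltW h0).
  apply: mulr_ge0; last by lra.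
  by rewrite !mulr_ge0 ?invr_ge0 ?subr_ge0 ?(ltW tau0) ?(ltW Gam0) ?(ltW h1).
apply: split_cone; rewrite ?mulr_gt0 ?pressure_lt// => t tl; rewrite -/k -/A.
have kK : - K <= k by have := ler_norm (- k); rewrite normrN -/K; lra.
split; first by lra.
have a1 : (l - K) ^+ 2 <= (t + k) ^+ 2.
  by rewrite ler_pXn2r ?nnegrE//; lra.
have a2 : l ^+ 2 <= t ^+ 2 by rewrite ler_pXn2r ?nnegrE//; lra.
have A0 := split_energy_ge0.
(* The worst case is t = l and k = -K, as t + k >= l - K >= 0. *)
suff : 0 <= (l - K) ^+ 2 * A + p ^+ 2 * (l ^+ 2 - sqn n).
  move/le_trans; apply; apply: lerD; first by rewrite ler_wpM2r.
  by rewrite ler_wpM2l ?sqr_ge0// lerD2r.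
rewrite -(pmulr_rge0 _ c20).
have -> : c ^+ 2 * ((l - K) ^+ 2 * A + p ^+ 2 * (l ^+ 2 - sqn n)) =
  (l - K) ^+ 2 * (A * c ^+ 2) -
   p ^+ 2 * w ^+ 2 * (c ^+ 2 * (1 - sqn nu) * (sqn n - l ^+ 2))
   + c ^+ 2 * p ^+ 2 * (l ^+ 2 - sqn n) * (1 - w ^+ 2 * (1 - sqn nu)) by ring.
rewrite wE subrr mulr0 addr0 -root_l.
have := ler_wpM2l (sqr_ge0 (l - K)) Ac; lra.
Qed.
End Speeds.
End Splitting.

(** * Recovery of the primitive variables and splitting in curved space *)

Section AtPoint.
Context {R : realType} (M : spacetime R) (x : event R).
Hypothesis Mx : spacetime_at M x.
Local Notation gam := (metric3 M x).
Local Notation Fr := (frame M x).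
Local Notation alp := (lapse M x).

(** A nonzero kernel row would be a null vector of the positive definite form. *)
Lemma metric3_unit : gam \in unitmx.
Proof.
rewrite -row_free_unit -kermx_eq0; apply/eqP/row_matrixP => i; rewrite row0.
apply/eqP/negPn/negP => r0.
have u0 : (row i (kermx gam))^T != 0.
  by apply: contraNneq r0 => /(congr1 trmx); rewrite trmxK trmx0 => ->.
have := metric3_pos Mx u0.
by rewrite trmxK -row_mul mulmx_ker row0 mul0mx mxE ltxx.
Qed.

Lemma frame_unit : Fr \in unitmx.
Proof.
have := metric3_unit; rewrite -unitmx_inv -(frameE Mx) unitmx_mul.
by case/andP.
Qed.

(** The inverse metric has determinant det(frame)^2, a nonzero square. *)
Lemma sqrt_gamma_gt0 : 0 < sqrt_gamma M x.
Proof.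
rewrite /sqrt_gamma sqrtr_gt0 -invr_gt0 -det_inv -(frameE Mx) det_mulmx det_tr.
rewrite -expr2 exprn_even_gt0//= -unitfE -unitmxE; exact: frame_unit.
Qed.

(** The frame maps covectors isometrically to Euclidean space, which is what reduces the splitting
    to flat space. *)
Lemma covec_sqrE u : covec_sqr M x u = sqn (Fr *m u).
Proof. by rewrite /covec_sqr /Upsilon -(frameE Mx) sqnE trmx_mul !mulmxA. Qed.

Lemma mul_delta_tr (l : 'I_3) (u : 'cV[R]_3) :
  ((delta_mx l 0 : 'cV[R]_3)^T *m u) 0 0 = u l 0.
Proof. by rewrite trmx_delta -rowE mxE. Qed.

Lemma vel_upE (z : prim) l :
  vel_up M x z l 0 = dotv (Fr *m delta_mx l 0) (Fr *m velocity z).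
Proof.
rewrite dotvE trmx_mul -mulmxA (mulmxA (Fr^T)) (frameE Mx).
by rewrite mul_delta_tr.
Qed.

Lemma Sigma_unit : Sigma M x \in unitmx.
Proof.
rewrite unitmxE /Sigma (@det_ublock _ 1 4) (@det_ublock _ 3 1) !det1.
by rewrite mul1r mulr1 -unitmxE frame_unit.
Qed.

Lemma W_of_UE W : W = sqrt_gamma M x *: (Sigma M x *m U_of_W M x W).
Proof.
rewrite /U_of_W -scalemxAr scalerA divff ?scale1r ?gt_eqF ?sqrt_gamma_gt0//.
by rewrite mulKVmx// Sigma_unit.
Qed.
End AtPoint.

Lemma Sigma_state5 (R : realType) (M : spacetime R) x d m E :
  Sigma M x *m state5 d m E = state5 d (frame M x *m m) E.
Proof.
rewrite /Sigma /state5 (@mul_block_col _ 1 4 1 4) (@mul_block_col _ 3 1 3 1).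
by rewrite !mul1mx !mul0mx !addr0 !add0r.
Qed.

Lemma Sigma_mul_row0 (R : realType) (M : spacetime R) x (U : 'cV[R]_5) :
  (Sigma M x *m U) 0 0 = U 0 0.
Proof.
by have [d [m [E ->]]] := state5_surj U; rewrite Sigma_state5 !state5_0.
Qed.

(** The first row of [Sigma] is constant, so its derivatives vanish, and [source_Q] has no density
    component. *)
Lemma S_source_row0 (R : realType) (e : R -> R -> R) (M : spacetime R) x
  (W : 'cV[R]_5) : S_source e M x W 0 0 = 0.
Proof.
have pS mu (U : 'cV[R]_5) : (partial_Sigma M mu x *m U) 0 0 = 0.
  rewrite mxE big1// => j _; rewrite mxE /partial.
  have -> : (fun y => Sigma M y 0 j) = cst ((delta_mx j 0 : 'cV[R]_5) 0 0).
    by apply/funext => y; rewrite /cst /= -(Sigma_mul_row0 M y) -colE [RHS]mxE.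
  by rewrite derive_cst mul0r.
rewrite mxE mxE pS mulr0 add0r mxE mxE state5_0 add0r summxE big1 ?mulr0//.
Qed.

Section Recovery.
Context {R : realType} (e : R -> R -> R) (M : spacetime R) (x : event R).
Hypothesis Mx : spacetime_at M x.
Hypothesis he : eos_admissible e.
Local Notation Fr := (frame M x).
Local Notation alp := (lapse M x).

Lemma prim_of_WP (W : 'cV[R]_5) : Gstar W ->
  physical e M x (prim_of_W e M x W) /\
  cons_of_prim e M x (prim_of_W e M x W) = U_of_W M x W.
Proof.
move=> [W0 qW].
suff : exists z, physical e M x z /\ cons_of_prim e M x z = U_of_W M x W.
  exact: (@getPex _ (fun z => physical e M x z /\ cons_of_prim e M x z = _)).
have [D [m [E UE]]] := state5_surj (U_of_W M x W); rewrite UE.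
have g0 := sqrt_gamma_gt0 Mx.
move: W0 qW; rewrite (W_of_UE Mx W) UE Sigma_state5 qZ ?(ltW g0)//.
rewrite state5Z state5_0 (pmulr_rgt0 _ g0) (pmulr_rgt0 _ g0) q_state5 subr_gt0.
set M2 := sqn _ => D0 ltE.
have M0 : 0 <= M2 by exact: sqn_ge0.
have E0 : 0 < E by apply: le_lt_trans ltE; exact: sqrtr_ge0.
have DME : D ^+ 2 + M2 < E ^+ 2.
  by rewrite -ltr_sqrt ?exprn_gt0// sqrtr_sqr gtr0_norm.
have [p p0 /=] := pressure_exists he D0 M0 E0 DME.
set kappa := Num.sqrt _ => pE.
have Ep0 : 0 < E + p by rewrite addr_gt0.
have r0 : 0 < (E + p) ^+ 2 - M2 by have := sqr_ge0 D; nra.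
have k0 : 0 < kappa by rewrite sqrtr_gt0.
have kE : kappa ^+ 2 = (E + p) ^+ 2 - M2 by rewrite sqr_sqrtr// ltW.
pose sig := kappa / (E + p).
have sig0 : 0 < sig by rewrite divr_gt0.
(* Since E + p = rho h w^2, the velocity is m / (E + p); then 1 - v^2 = [sig ^+ 2], so w = 1 / [sig]
   and rho = D / w. *)
pose z : prim := (D * sig, (E + p)^-1 *: m, p).
have sz : speed2 M x z = 1 - sig ^+ 2.
  rewrite /speed2 covec_sqrE// -scalemxAr sqnZ -/M2 /sig expr_div_n kE.
  by field; rewrite gt_eqF.
have lz : lorentz M x z = sig^-1.
  by rewrite /lorentz sz opprB addrC subrK sqrtr_sqr gtr0_norm.
have Dz : consD M x z = D by rewrite /consD lz mulfK// gt_eqF.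
have Bz : rhohw2 e M x z = E + p.
  rewrite /rhohw2 lz /enth /pressure /density /=.
  have -> : D * sig * enthalpy e p (D * sig) * sig^-1 ^+ 2 =
            D * enthalpy e p (D * sig) / sig by field; rewrite gt_eqF.
  by rewrite pE /sig; field; rewrite !gt_eqF.
exists z; split.
  split => //.
  - exact: mulr_gt0.
  - by apply: energy_gt0 => //; exact: mulr_gt0.
  - by rewrite -[ltRHS]sqrtr1 ltr_sqrt// sz gtrBl exprn_gt0.
rewrite /cons_of_prim /consm /consE Bz Dz /velocity /pressure /=.
by rewrite scalerA divff ?scale1r ?addrK// gt_eqF.
Qed.

Variable W : 'cV[R]_5.
Hypothesis GW : Gstar W.
Let z := prim_of_W e M x W.
Let nu := Fr *m velocity z.
Let B := rhohw2 e M x z.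
Let p := pressure z.
Let V := state5 (consD M x z) (B *: nu) (B - p).

Lemma W_primE : W = sqrt_gamma M x *: V.
Proof.
rewrite [LHS](W_of_UE Mx) -(prim_of_WP GW).2 /cons_of_prim Sigma_state5.
by rewrite -scalemxAr.
Qed.

(** In the frame the flux is the flat one in direction [n], and the shift contributes only a
    multiple of [V]. *)
Lemma H_fluxE (l : 'I_3) (n := Fr *m delta_mx l 0) (k := dotv n nu) :
  H_flux e M l x W = sqrt_g M x *:
    ((k - alp^-1 * shift M x l 0) *: V + p *: state5 0 n k).
Proof.
rewrite /H_flux /flux -/z Sigma_state5 mulmxDr -!scalemxAr; congr (_ *: _).
rewrite /V !state5Z state5D mulr0 addr0 /vel_tilde mxE vel_upE// -/n -/nu -/k.
rewrite !mxE -/p /consm /consE -/B /nu.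
by congr state5; rewrite ?(mulrC (consD _ _ _)) ?(mulrC (B - p)).
Qed.

(** The sign is absorbed into the normal [n'] and the shift into the speed, now
    [(a - sg * b) / alp]; what remains is the flat splitting. The shift term of [eta] pays for this
    change of speed. *)
Lemma LF_splitting (eta : 'cV[R]_3 -> event R -> 'cV[R]_5 -> R)
    (a sg : R) (l : 'I_3) : speed_bound e M eta -> (sg = 1 \/ sg = -1) ->
  eta (delta_mx l 0) x W <= a -> Gbar (a *: W + sg *: H_flux e M l x W).
Proof.
move=> heta sg1 eta_a.
have sg2 : sg ^+ 2 = 1 by case: sg1 => ->; rewrite ?sqrrN expr1n.
have sgn : `|sg| = 1 by case: sg1 => ->; rewrite ?normrN normr1.
pose n : 'cV[R]_3 := Fr *m delta_mx l 0.
pose n' := sg *: n.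
pose b := shift M x l 0.
have a0 := lapse_gt0 Mx; have g0 := sqrt_gamma_gt0 Mx.
have n'2 : sqn n' = sqn n by rewrite sqnZ sg2 mul1r.
have k'E : dotv n' nu = sg * dotv n nu.
  by rewrite /dotv mulr_sumr; apply: eq_bigr => i _; rewrite mxE mulrA.
have k'2 : dotv n' nu ^+ 2 = dotv n nu ^+ 2 by rewrite k'E exprMn sg2 mul1r.
have k'n : `|dotv n' nu| = `|dotv n nu| by rewrite k'E normrM sgn mul1r.
have -> : a *: W + sg *: H_flux e M l x W = (sqrt_gamma M x * alp) *:
   (((a - sg * b) / alp) *: V +
     (dotv n' nu *: V + p *: state5 0 n' (dotv n' nu))).
  rewrite H_fluxE -/n {1}W_primE k'E.
  have -> : state5 0 n' (sg * dotv n nu) = sg *: state5 0 n (dotv n nu).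
    by rewrite state5Z mulr0.
  move: (state5 _ _ _) V => T1 T2; apply/colP => i; rewrite !mxE /sqrt_g.
  by rewrite -/b; field; rewrite gt_eqF.
apply: GbarZ; first by rewrite mulr_ge0 ?ltW.
have [[rho0 p0 _ v1] _] := prim_of_WP GW; rewrite -/z in rho0 p0 v1.
have v2E : speed2 M x z = sqn nu by rewrite /speed2 covec_sqrE.
have nu1 : sqn nu < 1.
  rewrite -v2E; move: v1; rewrite -[X in _ < X -> _]sqrtr1 ltr_sqrt//.
have s0 : 0 < Num.sqrt (1 - sqn nu) by rewrite sqrtr_gt0 subr_gt0.
have wE : lorentz M x z = (Num.sqrt (1 - sqn nu))^-1 by rewrite /lorentz v2E.
have w0 : 0 < lorentz M x z by rewrite wE invr_gt0.
have w2 : lorentz M x z ^+ 2 * (1 - sqn nu) = 1.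
  by rewrite wE exprVn sqr_sqrtr ?mulVf// ?subr_ge0 ?ltW// gt_eqF// subr_gt0.
have [hb hb'] := enthalpy_bound he p0 rho0.
have h0 : 0 < enth e z.
  by apply: lt_trans hb'; rewrite mulr_gt0// divr_gt0.
have speed lambda : alp * (lambda + shift_speed M (delta_mx l 0) x) <= a ->
    lambda <= (a - sg * b) / alp.
  rewrite /shift_speed mul_delta_tr -/b mulrDr mulrCA divff ?gt_eqF// mulr1.
  rewrite ler_pdivlMr// (mulrC lambda) => H.
  have := ler_norm (sg * b); rewrite normrM sgn mul1r; lra.
have d0 : delta_mx l 0 != 0 :> 'cV[R]_3.
  apply/eqP => /matrixP /(_ l 0); rewrite !mxE !eqxx /= => /eqP.
  by rewrite oner_eq0.
case: heta eta_a => [etaE | [ideal etaE]]; rewrite etaE// => /speed.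
  by rewrite covec_sqrE// -n'2; exact: split_general.
have [Gam Gam12 /(_ _ _ p0 rho0)[Gtau cE]] := ideal_sound_speed he ideal.
rewrite -/z mul_delta_tr vel_upE// covec_sqrE// -/n -/nu -k'n -k'2 -n'2 v2E.
by apply: split_ideal Gam12 Gtau _ cE => //; exact: sqrtr_ge0.
Qed.
End Recovery.

(** * The Lax-Friedrichs step *)

Section Step.
Context {R : realType}.
Notation state := 'cV[R]_5.
Variables (dt : R) (dx a : 'I_3 -> R) (w src : grid_ix -> state).
Variables (H : 'I_3 -> grid_ix -> state) (lamS : grid_ix -> R).
Hypotheses (dt0 : 0 < dt) (dx0 : forall l, 0 < dx l).
Hypothesis w_in : forall c, Gstar (w c).
Hypothesis src0 : forall c, src c 0 0 = 0.
Hypothesis HD : forall l c, Gbar (a l *: w c + H l c).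
Hypothesis HB : forall l c, Gbar (a l *: w c - H l c).
Hypothesis hlamS : forall c, is_lambda_S (w c) (src c) (lamS c).
Hypothesis CFL : forall c, dt * (\sum_(l < 3) (dx l)^-1 * a l + lamS c) < 1.
Let LF l c := 2^-1 *: (H l c + H l (c + unit_ix l)
                       - a l *: (w (c + unit_ix l) - w c)).

Lemma LF_step_split c : LF_step dt dx w src LF c =
  ((1 - dt * \sum_(l < 3) (dx l)^-1 * a l) *: w c + dt *: src c) +
  \sum_(l < 3) (dt / (2 * dx l)) *:
    ((a l *: w (c - unit_ix l) + H l (c - unit_ix l)) +
     (a l *: w (c + unit_ix l) - H l (c + unit_ix l))).
Proof.
rewrite /LF_step /L_op scalerDr scalerBl scale1r -!addrA; congr (_ + _).
rewrite addrCA; congr (_ + _).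
rewrite mulr_sumr scaler_suml -sumrN scaler_sumr -big_split /=.
apply: eq_bigr => l _; rewrite /LF subrK.
apply/colP => i; rewrite !mxE; field; rewrite gt_eqF//.
Qed.

(** If q(S) >= 0, the source itself lies in the closed cone, its first component being 0. Otherwise
    weight [dt * lamS c] is moved from [w c] to the point [w c + (lamS c)^-1 *: src c], where [q]
    vanishes; the CFL condition keeps the remaining weight positive. *)
Lemma source_step c :
  Gstar ((1 - dt * \sum_(l < 3) (dx l)^-1 * a l) *: w c + dt *: src c).
Proof.
set A := \sum_(l < 3) _; have := CFL c; have := hlamS c; rewrite -/A.
rewrite /is_lambda_S; case: ifPn => [q0 ->|_ [l0 ql]].
  rewrite addr0 -subr_gt0 => A1; apply: GstarD; first exact: GstarZ.
  by apply: GbarZ; [exact: ltW|split; rewrite ?src0].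
rewrite mulrDr -subr_gt0 => A1.
have -> : (1 - dt * A) *: w c + dt *: src c =
  (1 - (dt * A + dt * lamS c)) *: w c +
  (dt * lamS c) *: (w c + (lamS c)^-1 *: src c).
  by apply/colP => i; rewrite !mxE; field; rewrite gt_eqF.
apply: GstarD; first exact: GstarZ.
apply: GbarZ; first by rewrite mulr_ge0 ?ltW.
split; last by rewrite ql.
by rewrite mxE [X in _ + X]mxE src0 mulr0 addr0 ltW//; case: (w_in c).
Qed.

Lemma LF_step_Gstar c : Gstar (LF_step dt dx w src LF c).
Proof.
rewrite LF_step_split; apply: GstarD; first exact: source_step.
apply: Gbar_sum => l; apply: GbarZ; last exact: GbarD.
by rewrite divr_ge0 ?mulr_ge0 ?ltW.
Qed.
End Step.

Theorem theorem3 (R : realType)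
  (e : R -> R -> R) (he : eos_admissible e)
  (M : spacetime R) (Omega : set (event R)) (Omega_open : open Omega)
  (hM : forall x, Omega x -> spacetime_at M x)
  (eta : 'cV[R]_3 -> event R -> 'cV[R]_5 -> R) (heta : speed_bound e M eta)
  (xo dx : 'I_3 -> R) (hdx : forall l, 0 < dx l)
  (t dt : nat -> R) (ht0 : t 0%N = 0)
  (htS : forall n, t n.+1 = t n + dt n) (hdt : forall n, 0 < dt n)
  (X : nat -> grid_ix -> event R)
  (hX : forall n c, X n c = grid_event (t n) xo dx c)
  (hOmega : forall n c, Omega (X n c))
  (W : nat -> grid_ix -> 'cV[R]_5)
  (S : nat -> grid_ix -> 'cV[R]_5)
  (hS : forall n c, S n c = S_source e M (X n c) (W n c))
  (a : nat -> 'I_3 -> R)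
  (ha : forall n l c, eta (delta_mx l 0) (X n c) (W n c) <= a n l)
  (LF : nat -> 'I_3 -> grid_ix -> 'cV[R]_5)
  (hLF : forall n, LF n = LF_flux e M (a n) (X n) (W n))
  (high : nat -> 'I_3 -> grid_ix -> 'cV[R]_5)
  (eps0 : R) (heps0 : 0 < eps0)
  (eps : nat -> R)
  (heps : forall n, is_limiter_eps (dt n) dx (W n) (S n) (LF n) (eps n))
  (lam : nat -> grid_ix -> {ffun face -> bool} -> R)
  (hlam : forall n, is_vertex_scaling (dt n) dx (W n) (S n) (high n) (LF n)
                      (eps n) eps0 (lam n))
  (theta : nat -> 'I_3 -> grid_ix -> R)
  (htheta : forall n, theta n =
     limiter_theta (dt n) dx (W n) (S n) (high n) (LF n) (eps n) eps0 (lam n))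
  (scheme : forall n c, W n.+1 c = W n c +
     dt n *: L_op dx (S n) (limited_flux (theta n) (high n) (LF n)) c)
  (lamS : nat -> grid_ix -> R)
  (hlamS : forall n c, is_lambda_S (W n c) (S n c) (lamS n c))
  (CFL : forall n c, dt n * (\sum_(l < 3) (dx l)^-1 * a n l + lamS n c) < 1) :
  (forall c, Gstar (W 0%N c)) -> forall n c, Gstar (W n c).
Proof.
move=> W0; elim=> // n IH c.
have H1 l d : Gbar (a n l *: W n d + H_flux e M l (X n d) (W n d)).
  have := LF_splitting (hM _ (hOmega n d)) he (IH d) heta (or_introl erefl)
    (ha n l d).
  by rewrite scale1r.
have H2 l d : Gbar (a n l *: W n d - H_flux e M l (X n d) (W n d)).
  have := LF_splitting (hM _ (hOmega n d)) he (IH d) heta (or_intror erefl)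
    (ha n l d).
  by rewrite scaleN1r.
have stepG d : Gstar (LF_step (dt n) dx (W n) (S n) (LF n) d).
  rewrite hLF; apply: (LF_step_Gstar (hdt n) hdx IH _ H1 H2 (hlamS n) (CFL n)).
  by move=> d'; rewrite hS S_source_row0.
have [eps_in eps_min] := heps n.
(* [eps n] is an attained minimum, so it equals one of the candidates, each of which is positive. *)
have eps_gt0 : 0 < eps n.
  by case: eps_in => [->|[[d ->]|[d ->]]]; [|case: (stepG d)..].
have eps_le d : eps n <= LF_step (dt n) dx (W n) (S n) (LF n) d 0 0 /\
                eps n <= q (LF_step (dt n) dx (W n) (S n) (LF n) d).
  by split; apply: eps_min; right; [left|right]; exists d.
have [/and3P[_ th0 thq] thE] :=
  limited_step_in_Theta (high := high n) heps0 eps_le (hlam n) c.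
by rewrite scheme htheta -thE; split; apply: lt_le_trans eps_gt0 _.
Qed.
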